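(* Let $l_1=0$, $l_2\in\{1,-1\}$. Then $$\mathrm{Out}(BMG)\cong\big(U(\mathcal R_3(\mathbb Z))/M\big)\rtimes\mathcal K,$$ where $M=\{t^{x_1}(t+l_2)^{x_2}: x_1,x_2\in\mathbb Z\}$ is the set of monomials with coefficient one, and $\mathcal K\cong\mathbb Z_2$ is the group $\left\{\begin{pmatrix}1&0\\0&1\end{pmatrix},\begin{pmatrix}-1&-1\\0&1\end{pmatrix}\right\}$ if $l_2=1$ and $\left\{\begin{pmatrix}1&0\\0&1\end{pmatrix},\begin{pmatrix}1&0\\-1&-1\end{pmatrix}\right\}$ if $l_2=-1$.
   Context: Baumslag's metabelian group is $BMG=\langle a,s,t\mid st=ts,\ [a,a^t],\ aa^s=a^t\rangle$ (with $a^g=gag^{-1}$). For $l_1=0$ and either choice $l_2=\pm1$, it is isomorphic to $\mathcal R_3(\mathbb Z)\rtimes\mathbb Z^2$, where $\mathcal R_3(\mathbb Z)=\mathbb Z[t,(t+l_1)^{-1},(t+l_2)^{-1}]$ (localization of the polynomial ring $\mathbb Z[t]$) and $\mathbf v=(v_1,v_2)\in\mathbb Z^2$ acts on $\mathcal R_3(\mathbb Z)$ by $P^{\mathbf v}=P\,t^{v_1}(t+l_2)^{v_2}$. $U(\cdot)$ denotes the group of units, $\mathrm{Out}$ the outer automorphism group. Elements $\beta\in\mathcal K\subset\mathrm{Aut}(\mathbb Z^2)$ are given by matrices with respect to the standard basis (columns are images of basis vectors). Each $\beta\in\mathcal K$ acts on $\mathcal R_3(\mathbb Z)$ by the ring automorphism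 sending $t^{v_1}(t+l_2)^{v_2}$ to $t^{w_1}(t+l_2)^{w_2}$ with $\mathbf w=\beta(\mathbf v)$; this preserves $U(\mathcal R_3(\mathbb Z))$ and $M$ and gives the action of $\mathcal K$ on $U(\mathcal R_3(\mathbb Z))/M$. *)

(* Defs.v *)
From HB Require Import structures.
From mathcomp Require Import all_boot all_order all_algebra.
From mathcomp Require Import boolp.

Set Implicit Arguments.
Unset Strict Implicit.
Unset Printing Implicit Defensive.

Import GRing.Theory.

Local Open Scope group_scope.

Definition isogg (G H : groupType) : Prop :=
  exists f : {multiplicative G -> H}, bijective f.

Lemma gmulf1g (G H : groupType) (f : {multiplicative G -> H}) : f 1 = 1.
Proof. by apply: (mulgI (f 1)); rewrite -gmulfM !mulg1. Qed.

Record normal_subgroup (G : groupType) := NormalSubgroup {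
  nsg :> {pred G};
  nsg_closed : group_closed nsg;
  nsg_conj : forall x y, x \in nsg -> x ^ y \in nsg }.

Section Quotient.
Variables (G : groupType) (N : normal_subgroup G).

Lemma nsg1 : 1 \in N. Proof. exact: (nsg_closed N).1. Qed.
Lemma nsgF x y : x \in N -> y \in N -> x / y \in N.
Proof. exact: (nsg_closed N).2. Qed.
Lemma nsgV x : x \in N -> x^-1 \in N.
Proof. by move=> Nx; rewrite -[_^-1]mul1g nsgF // nsg1. Qed.
Lemma nsgM x y : x \in N -> y \in N -> x * y \in N.
Proof. by move=> Nx Ny; rewrite -[y]invgK nsgF // nsgV. Qed.

Definition coset_eq : rel G := fun x y => x^-1 * y \in N.

Lemma coset_eq_refl : reflexive coset_eq.
Proof. by move=> x; rewrite /coset_eq mulVg nsg1. Qed.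
Lemma coset_eq_sym : symmetric coset_eq.
Proof.
have sub x y : coset_eq x y -> coset_eq y x.
  by rewrite /coset_eq => /nsgV; rewrite invgM invgK.
by move=> x y; apply/idP/idP; apply: sub.
Qed.
Lemma coset_eq_trans : transitive coset_eq.
Proof.
move=> y x z xy yz; rewrite /coset_eq.
by have := nsgM xy yz; rewrite mulgA -(mulgA x^-1) mulgV mulg1.
Qed.

Canonical coset_eq_equiv :=
  EquivRel coset_eq coset_eq_refl coset_eq_sym coset_eq_trans.

Definition quotg := {eq_quot coset_eq}%qT.
HB.instance Definition _ : EqQuotient _ coset_eq quotg := EqQuotient.on quotg.
HB.instance Definition _ := Choice.on quotg.

Definition cosetg (x : G) : quotg := \pi_quotg%qT x.

Lemma cosetgP x y : (cosetg x = cosetg y) <-> (x^-1 * y \in N).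
Proof. by split=> [/eqmodP|?]; last apply/eqmodP. Qed.

Lemma cosetg_repr q : cosetg (repr q) = q.
Proof. exact: reprK. Qed.

Definition quot_mul (p q : quotg) : quotg := cosetg (repr p * repr q).
Definition quot_inv (p : quotg) : quotg := cosetg (repr p)^-1.

Lemma quot_mulE x y : quot_mul (cosetg x) (cosetg y) = cosetg (x * y).
Proof.
apply/cosetgP; set x' := repr _; set y' := repr _.
have xx' : x'^-1 * x \in N by apply/cosetgP; rewrite cosetg_repr.
have yy' : y'^-1 * y \in N by apply/cosetgP; rewrite cosetg_repr.
have -> : (x' * y')^-1 * (x * y) = (x'^-1 * x) ^ y' * (y'^-1 * y).
  by rewrite invgM /conjg -!mulgA mulVKg.
by apply: nsgM => //; apply: nsg_conj.
Qed.

Lemma quot_invE x : quot_inv (cosetg x) = cosetg x^-1.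
Proof.
apply/cosetgP; set x' := repr _.
have xx' : x'^-1 * x \in N by apply/cosetgP; rewrite cosetg_repr.
have := nsgV (nsg_conj x'^-1 xx').
by rewrite /conjg invgK -(mulgA x'^-1) mulVKg invgM invgK.
Qed.

Lemma quot_mulA : associative quot_mul.
Proof.
move=> p q r; rewrite -(cosetg_repr p) -(cosetg_repr q) -(cosetg_repr r).
by rewrite !quot_mulE mulgA.
Qed.
Lemma quot_mul1 : left_id (cosetg 1) quot_mul.
Proof. by move=> p; rewrite -(cosetg_repr p) !quot_mulE mul1g. Qed.
Lemma quot_1mul : right_id (cosetg 1) quot_mul.
Proof. by move=> p; rewrite -(cosetg_repr p) !quot_mulE mulg1. Qed.
Lemma quot_mulV : left_inverse (cosetg 1) quot_inv quot_mul.
Proof. by move=> p; rewrite -(cosetg_repr p) quot_invE !quot_mulE mulVg. Qed.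
Lemma quot_Vmul : right_inverse (cosetg 1) quot_inv quot_mul.
Proof. by move=> p; rewrite -(cosetg_repr p) quot_invE !quot_mulE mulgV. Qed.

HB.instance Definition _ := isGroup.Build quotg
  quot_mulA quot_mul1 quot_1mul quot_mulV quot_Vmul.

Lemma cosetgM x y : cosetg (x * y) = cosetg x * cosetg y.
Proof. by rewrite -quot_mulE. Qed.

End Quotient.
Arguments quotg : clear implicits.
Arguments cosetg {G} N x.

Section Automorphisms.
Variable G : groupType.

Record autg := Autg {
  autg_fun :> G -> G;
  autgM : {morph autg_fun : x y / x * y};
  autg_bij : bijective autg_fun }.

Lemma autg_ext (f g : autg) : f =1 g -> f = g.
Proof.
case: f g => [f fM fB] [g gM gB] /= /funext fg; subst g.
by congr Autg; apply: Prop_irrelevance.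
Qed.

HB.instance Definition _ := gen_eqMixin autg.
HB.instance Definition _ := gen_choiceMixin autg.

Definition autg_id : autg :=
  @Autg idfun (fun _ _ => erefl) (inv_bij (fun=> erefl)).

Fact autg_comp_morph (f g : autg) : {morph f \o g : x y / x * y}.
Proof. by move=> x y /=; rewrite !autgM. Qed.

Definition autg_comp (f g : autg) : autg :=
  Autg (autg_comp_morph f g) (bij_comp (autg_bij f) (autg_bij g)).

Fact autg_inv_subproof (f : autg) : exists g : autg, cancel f g /\ cancel g f.
Proof.
have [g fK gK] := autg_bij f.
have gM : {morph g : x y / x * y}.
  by move=> x y; apply: (can_inj fK); rewrite autgM !gK.
by exists (Autg gM (Bijective gK fK)).
Qed.

Definition autg_inv (f : autg) : autg := sval (cid (autg_inv_subproof f)).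

Lemma autgK (f : autg) : cancel f (autg_inv f).
Proof. exact: (svalP (cid (autg_inv_subproof f))).1. Qed.
Lemma autgVK (f : autg) : cancel (autg_inv f) f.
Proof. exact: (svalP (cid (autg_inv_subproof f))).2. Qed.

Fact autg_compA : associative autg_comp.
Proof. by move=> f g h; apply: autg_ext. Qed.
Fact autg_comp1 : left_id autg_id autg_comp.
Proof. by move=> f; apply: autg_ext. Qed.
Fact autg_1comp : right_id autg_id autg_comp.
Proof. by move=> f; apply: autg_ext. Qed.
Fact autg_compV : left_inverse autg_id autg_inv autg_comp.
Proof. by move=> f; apply: autg_ext => x /=; rewrite autgK. Qed.
Fact autg_Vcomp : right_inverse autg_id autg_inv autg_comp.
Proof. by move=> f; apply: autg_ext => x /=; rewrite autgVK. Qed.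

HB.instance Definition _ := isGroup.Build autg
  autg_compA autg_comp1 autg_1comp autg_compV autg_Vcomp.

Definition inner : {pred autg} :=
  fun f => `[< exists g, forall x, f x = g * x * g^-1 >].

Fact inner_closed : group_closed inner.
Proof.
split=> [|f h /asboolP[a fa] /asboolP[b hb]]; apply/asboolP.
  by exists 1 => x; rewrite mul1g invg1 mulg1.
have hV x : h^-1 x = b^-1 * x * b.
  by apply: (can_inj (autgK h)); rewrite autgVK hb !mulgA mulgV mul1g mulgK.
exists (a / b) => x.
by rewrite [LHS](fa (h^-1 x)) hV invgM invgK !mulgA.
Qed.

Fact inner_conj (f h : autg) : f \in inner -> f ^ h \in inner.
Proof.
move=> /asboolP[a fa]; apply/asboolP; exists (h^-1 a) => x.
have hVh y : h^-1 (h y) = y by exact: autgK.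
rewrite [LHS](_ : _ = h^-1 (f (h x))) // fa !autgM hVh; congr (_ * _).
apply: (mulgI (h^-1 a)); rewrite mulgV -autgM mulgV.
by apply: (mulgI (h^-1 1)); rewrite -autgM !mulg1.
Qed.

Definition Inn : normal_subgroup autg := NormalSubgroup inner_closed inner_conj.

Definition Out := quotg autg Inn.
HB.instance Definition _ := Choice.on Out.
HB.instance Definition _ := Group.on Out.

End Automorphisms.

Section SemidirectProduct.
Variables N K : groupType.

(* The parameter [_theta] does not occur in the fields; it makes the type
   determine the action, hence the group law. *)
Record sdprodg (_theta : {multiplicative K -> autg N}) :=
  Sdprod { sd_l : N; sd_r : K }.

Variable theta : {multiplicative K -> autg N}.
Local Notation T := (sdprodg theta).

Definition sdprod_pair (x : T) := (sd_l x, sd_r x).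
Definition pair_sdprod (p : N * K) : T := Sdprod theta p.1 p.2.
Fact sdprod_pairK : cancel sdprod_pair pair_sdprod. Proof. by case. Qed.

HB.instance Definition _ := Choice.copy T (can_type sdprod_pairK).

Definition sd_mul (x y : T) : T :=
  Sdprod theta (sd_l x * theta (sd_r x) (sd_l y)) (sd_r x * sd_r y).
Definition sd_one : T := Sdprod theta 1 1.
Definition sd_inv (x : T) : T :=
  Sdprod theta (theta (sd_r x)^-1 (sd_l x)^-1) (sd_r x)^-1.

Lemma autg1 (f : autg N) : f 1 = 1.
Proof. by apply: (mulgI (f 1)); rewrite -autgM !mulg1. Qed.
Lemma theta1 n : theta 1 n = n. Proof. by rewrite gmulf1g. Qed.
Lemma thetaM k k' n : theta (k * k') n = theta k (theta k' n).
Proof. by rewrite gmulfM. Qed.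

Fact sd_mulA : associative sd_mul.
Proof.
by move=> [a i] [b j] [c k]; rewrite /sd_mul /= thetaM autgM !mulgA.
Qed.
Fact sd_mul1 : left_id sd_one sd_mul.
Proof. by case=> a i; rewrite /sd_mul /= theta1 !mul1g. Qed.
Fact sd_1mul : right_id sd_one sd_mul.
Proof. by case=> a i; rewrite /sd_mul /= autg1 !mulg1. Qed.
Fact sd_mulV : left_inverse sd_one sd_inv sd_mul.
Proof. by case=> a i; rewrite /sd_mul /= -autgM !mulVg autg1. Qed.
Fact sd_Vmul : right_inverse sd_one sd_inv sd_mul.
Proof. by case=> a i; rewrite /sd_mul /= -thetaM !mulgV theta1 mulgV. Qed.

HB.instance Definition _ := isGroup.Build T
  sd_mulA sd_mul1 sd_1mul sd_mulV sd_Vmul.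

End SemidirectProduct.
Arguments sdprodg : clear implicits.

Section Presentation.
Variable X : choiceType.

(* The letter [(x, true)] stands for the generator [x], and [(x, false)] for
   its formal inverse. *)
Definition word := seq (X * bool).

Definition inv_word (w : word) : word := rev [seq (l.1, ~~ l.2) | l <- w].

(* A relation [(u, v)] stands for the equation [u = v]. *)
Variable rels : seq (word * word).

Inductive pres_eqv : word -> word -> Prop :=
| pres_refl w : pres_eqv w w
| pres_sym u v : pres_eqv u v -> pres_eqv v u
| pres_trans u v w : pres_eqv u v -> pres_eqv v w -> pres_eqv u w
| pres_cancel u v x b : pres_eqv (u ++ [:: (x, b); (x, ~~ b)] ++ v) (u ++ v)
| pres_rel u v r : r \in rels -> pres_eqv (u ++ r.1 ++ v) (u ++ r.2 ++ v).

Lemma pres_ctx p q u v : pres_eqv u v -> pres_eqv (p ++ u ++ q) (p ++ v ++ q).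
Proof.
elim=> {u v} [w|u v _|u v w _ h1 _ h2|u v x b|u v r rr].
- exact: pres_refl.
- exact: pres_sym.
- exact: pres_trans h1 h2.
- by have := pres_cancel (p ++ u) (v ++ q) x b; rewrite -!catA.
- by have := pres_rel (p ++ u) (v ++ q) rr; rewrite -!catA.
Qed.

Lemma pres_cat u u' v v' :
  pres_eqv u u' -> pres_eqv v v' -> pres_eqv (u ++ v) (u' ++ v').
Proof.
move=> uu' vv'; apply: (@pres_trans _ (u' ++ v)).
  exact: (pres_ctx [::] v uu').
by have := pres_ctx u' [::] vv'; rewrite !cats0.
Qed.

Lemma inv_word_cat u v : inv_word (u ++ v) = inv_word v ++ inv_word u.
Proof. by rewrite /inv_word map_cat rev_cat. Qed.
Lemma inv_wordK : involutive inv_word.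
Proof.
move=> w; rewrite /inv_word map_rev revK -map_comp -[RHS]map_id.
by apply: eq_map => -[x b] /=; rewrite negbK.
Qed.

Lemma pres_mulV w : pres_eqv (w ++ inv_word w) [::].
Proof.
elim: w => [|[x b] w IH]; first exact: pres_refl.
rewrite -cat1s inv_word_cat -catA [w ++ _ ++ _]catA.
apply: pres_trans (pres_ctx _ _ IH) _.
exact: (pres_cancel [::] [::] x b).
Qed.
Lemma pres_Vmul w : pres_eqv (inv_word w ++ w) [::].
Proof. by have := pres_mulV (inv_word w); rewrite inv_wordK. Qed.

Lemma pres_inv u v : pres_eqv u v -> pres_eqv (inv_word u) (inv_word v).
Proof.
move=> uv; apply: (@pres_trans _ (inv_word u ++ v ++ inv_word v)).
  apply: pres_sym; rewrite -[X in pres_eqv _ X]cats0.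
  exact: pres_cat (pres_refl _) (pres_mulV v).
rewrite catA; apply: (@pres_trans _ ((inv_word u ++ u) ++ inv_word v)).
  apply: pres_cat (pres_refl _); apply: pres_cat (pres_refl _) _.
  exact: pres_sym.
exact: pres_cat (pres_Vmul u) (pres_refl _).
Qed.

Definition pres_eq : rel word := fun u v => `[< pres_eqv u v >].

Fact pres_eq_refl : reflexive pres_eq.
Proof. by move=> w; apply/asboolP/pres_refl. Qed.
Fact pres_eq_sym : symmetric pres_eq.
Proof. by move=> u v; apply/asboolP/asboolP; apply: pres_sym. Qed.
Fact pres_eq_trans : transitive pres_eq.
Proof.
by move=> v u w /asboolP uv /asboolP vw; apply/asboolP/(pres_trans uv vw).
Qed.

Canonical pres_eq_equiv :=
  EquivRel pres_eq pres_eq_refl pres_eq_sym pres_eq_trans.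

Definition presg := {eq_quot pres_eq}%qT.
HB.instance Definition _ : EqQuotient _ pres_eq presg := EqQuotient.on presg.
HB.instance Definition _ := Choice.on presg.

Definition wordg (w : word) : presg := \pi_presg%qT w.

Lemma wordgP u v : (wordg u = wordg v) <-> pres_eqv u v.
Proof.
by split=> [/eqmodP/asboolP|uv]; last by apply/eqmodP/asboolP.
Qed.
Lemma wordg_repr q : wordg (repr q) = q.
Proof. exact: reprK. Qed.

Definition pres_mul (p q : presg) : presg := wordg (repr p ++ repr q).
Definition pres_invg (p : presg) : presg := wordg (inv_word (repr p)).

Lemma pres_mulE u v : pres_mul (wordg u) (wordg v) = wordg (u ++ v).
Proof. by apply/wordgP/pres_cat; apply/wordgP; rewrite wordg_repr. Qed.
Lemma pres_invE u : pres_invg (wordg u) = wordg (inv_word u).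
Proof. by apply/wordgP/pres_inv; apply/wordgP; rewrite wordg_repr. Qed.

Fact pres_mulgA : associative pres_mul.
Proof.
move=> p q r; rewrite -(wordg_repr p) -(wordg_repr q) -(wordg_repr r).
by rewrite !pres_mulE catA.
Qed.
Fact pres_mul1g : left_id (wordg [::]) pres_mul.
Proof. by move=> p; rewrite -(wordg_repr p) pres_mulE. Qed.
Fact pres_mulg1 : right_id (wordg [::]) pres_mul.
Proof. by move=> p; rewrite -(wordg_repr p) pres_mulE cats0. Qed.
Fact pres_mulVg : left_inverse (wordg [::]) pres_invg pres_mul.
Proof.
move=> p; rewrite -(wordg_repr p) pres_invE pres_mulE.
exact/wordgP/pres_Vmul.
Qed.
Fact pres_mulgV : right_inverse (wordg [::]) pres_invg pres_mul.
Proof.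
move=> p; rewrite -(wordg_repr p) pres_invE pres_mulE.
exact/wordgP/pres_mulV.
Qed.

HB.instance Definition _ := isGroup.Build presg
  pres_mulgA pres_mul1g pres_mulg1 pres_mulVg pres_mulgV.

Lemma wordgM u v : wordg (u ++ v) = wordg u * wordg v.
Proof. by rewrite -pres_mulE. Qed.

End Presentation.

Definition gen_a : word 'I_3 := [:: (inord 0, true)].
Definition gen_s : word 'I_3 := [:: (inord 1, true)].
Definition gen_t : word 'I_3 := [:: (inord 2, true)].

Definition conj_word (X : choiceType) (x g : word X) : word X :=
  g ++ x ++ inv_word g.
Definition comm_word (X : choiceType) (x y : word X) : word X :=
  x ++ y ++ inv_word x ++ inv_word y.

Definition BMG_rels : seq (word 'I_3 * word 'I_3) :=
  [:: (gen_s ++ gen_t, gen_t ++ gen_s);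
      (comm_word gen_a (conj_word gen_a gen_t), [::]);
      (gen_a ++ conj_word gen_a gen_s, conj_word gen_a gen_t)].

Definition BMG := presg BMG_rels.
HB.instance Definition _ := Choice.on BMG.
HB.instance Definition _ := Group.on BMG.

Local Open Scope ring_scope.

Section Units.
Variable R : unitRingType.

Record unitg := Unitg { uval :> R; _ : uval \is a GRing.unit }.
HB.instance Definition _ := [isSub for uval].
HB.instance Definition _ := [Choice of unitg by <:].

Lemma uvalP (u : unitg) : (u : R) \is a GRing.unit. Proof. exact: valP. Qed.

Fact unitg_mul_subproof (u v : unitg) : uval u * uval v \is a GRing.unit.
Proof. by rewrite unitrMr uvalP. Qed.
Fact unitg_inv_subproof (u : unitg) : (uval u)^-1 \is a GRing.unit.
Proof. by rewrite unitrV uvalP. Qed.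

Definition unitg_one : unitg := Unitg (unitr1 R).
Definition unitg_mul (u v : unitg) : unitg := Unitg (unitg_mul_subproof u v).
Definition unitg_inv (u : unitg) : unitg := Unitg (unitg_inv_subproof u).

Fact unitg_mulA : associative unitg_mul.
Proof. by move=> u v w; apply/val_inj; rewrite /= mulrA. Qed.
Fact unitg_mul1 : left_id unitg_one unitg_mul.
Proof. by move=> u; apply/val_inj; rewrite /= mul1r. Qed.
Fact unitg_1mul : right_id unitg_one unitg_mul.
Proof. by move=> u; apply/val_inj; rewrite /= mulr1. Qed.
Fact unitg_mulV : left_inverse unitg_one unitg_inv unitg_mul.
Proof. by move=> u; apply/val_inj; rewrite /= mulVr // uvalP. Qed.
Fact unitg_Vmul : right_inverse unitg_one unitg_inv unitg_mul.
Proof. by move=> u; apply/val_inj; rewrite /= divrr // uvalP. Qed.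

HB.instance Definition _ := isGroup.Build unitg
  unitg_mulA unitg_mul1 unitg_1mul unitg_mulV unitg_Vmul.

Lemma uvalM (u v : unitg) : uval (u * v)%g = uval u * uval v. Proof. by []. Qed.
Lemma uvalV (u : unitg) : uval (u^-1)%g = (uval u)^-1. Proof. by []. Qed.
Lemma uval1 : uval 1%g = 1. Proof. by []. Qed.
Lemma uval_inj : injective uval. Proof. exact: val_inj. Qed.

End Units.

Local Notation tofrac := (@FracField.tofrac {poly int}).

Section SubringOf.
Variables (F : fieldType) (S : {pred F}) (Scl : subring_closed S).

Record subring_of (_cl : subring_closed S) := SubringOf {
  subring_val :> F; _ : subring_val \in S }.

Local Notation T := (subring_of Scl).
HB.instance Definition _ := [isSub of T for @subring_val Scl].
HB.instance Definition _ := [Choice of T by <:].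
HB.instance Definition _ := GRing.SubChoice_isSubComNzRing.Build _ _ T Scl.

Definition subring_unit : {pred T} := fun x => (val x != 0) && ((val x)^-1 \in S).
Definition subring_inv (x : T) : T :=
  if subring_unit x then insubd x (val x)^-1 else x.

Fact subring_mulVx : {in subring_unit, left_inverse 1 subring_inv *%R}.
Proof.
move=> x ux; have /andP[x0 xV] := ux; apply/val_inj.
rewrite rmorphM rmorph1 /= /subring_inv (ux : subring_unit x).
by rewrite -[subring_val _]/(val _) val_insubd xV mulVf.
Qed.
Fact subring_unitPl (x y : T) : y * x = 1 -> subring_unit x.
Proof.
move=> /(congr1 val); rewrite rmorphM rmorph1 => yx1.
have x0 : val x != 0.
  by apply: contra_eq_neq yx1 => /= ->; rewrite mulr0 eq_sym oner_eq0.
rewrite /subring_unit x0 -(_ : val y = (val x)^-1) ?(valP y) //.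
by apply: (mulIf x0); rewrite mulVf.
Qed.
Fact subring_invx_out : {in [predC subring_unit], subring_inv =1 id}.
Proof. by move=> x /negbTE nux; rewrite /subring_inv [subring_unit x]nux. Qed.

HB.instance Definition _ := GRing.ComNzRing_hasMulInverse.Build T
  subring_mulVx subring_unitPl subring_invx_out.

Lemma subring_unitP (x : T) :
  reflect (val x != 0 /\ (val x)^-1 \in S) (x \is a GRing.unit).
Proof. exact: andP. Qed.

Lemma subring_valM (x y : T) :
  subring_val (x * y) = subring_val x * subring_val y.
Proof. exact: (rmorphM val). Qed.

End SubringOf.

Section RmorphFrac.
Variables (R : comNzRingType) (F : fieldType) (f : {rmorphism R -> F}).

Lemma rmorph_fracB p q d d' : f d != 0 -> f d' != 0 ->
  f p / f d - f q / f d' = f (p * d' - q * d) / f (d * d').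
Proof.
by move=> d0 d0'; rewrite -mulNr addf_div // mulNr !rmorphM rmorphB !rmorphM.
Qed.
Lemma rmorph_fracM p q d d' :
  f p / f d * (f q / f d') = f (p * q) / f (d * d').
Proof. by rewrite mulf_div !rmorphM. Qed.

End RmorphFrac.

Section R3.
Variables l1 l2 : int.

Definition R3_den (m n : nat) : {poly int} :=
  ('X + l1%:P) ^+ m * ('X + l2%:P) ^+ n.

Definition R3_pred : {pred {fraction {poly int}}} :=
  fun x => `[< exists (p : {poly int}) (m n : nat),
                 x = tofrac p / tofrac (R3_den m n) >].

Lemma R3_den_neq0 m n : R3_den m n != 0.
Proof.
have nz (l : int) : 'X + l%:P != 0.
  by rewrite -size_poly_gt0 size_XaddC.
by rewrite mulf_neq0 // expf_neq0.
Qed.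
Lemma tofrac_den_neq0 m n : tofrac (R3_den m n) != 0.
Proof. by rewrite tofrac_eq0 R3_den_neq0. Qed.
Lemma R3_denD m n m' n' :
  R3_den (m + m') (n + n') = R3_den m n * R3_den m' n'.
Proof. by rewrite /R3_den !exprD mulrACA. Qed.
Lemma R3_den0 : R3_den 0 0 = 1. Proof. by rewrite /R3_den !expr0 mulr1. Qed.

Fact R3_subring_closed : subring_closed R3_pred.
Proof.
split=> [|x y /asboolP[p [m [n ->]]] /asboolP[q [m' [n' ->]]]
         |x y /asboolP[p [m [n ->]]] /asboolP[q [m' [n' ->]]]]; apply/asboolP.
- by exists 1, 0%N, 0%N; rewrite R3_den0 tofrac1 divr1.
- exists (p * R3_den m' n' - q * R3_den m n), (m + m')%N, (n + n')%N.
  have := rmorph_fracB (f := tofrac) p q (tofrac_den_neq0 m n)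
    (tofrac_den_neq0 m' n').
  by rewrite -R3_denD; apply.
- exists (p * q), (m + m')%N, (n + n')%N.
  by rewrite R3_denD; apply: (rmorph_fracM tofrac).
Qed.

Definition R3 := subring_of R3_subring_closed.
HB.instance Definition _ := GRing.ComUnitRing.on R3.
HB.instance Definition _ := SubType.on R3.

Fact R3_poly_subproof p : tofrac p \in R3_pred.
Proof. by apply/asboolP; exists p, 0%N, 0%N; rewrite R3_den0 tofrac1 divr1. Qed.
Definition R3_poly (p : {poly int}) : R3 :=
  SubringOf R3_subring_closed (R3_poly_subproof p).

Fact R3_poly_zmod_morphism : zmod_morphism R3_poly.
Proof. by move=> p q; apply/val_inj; rewrite rmorphB /= tofracB. Qed.
Fact R3_poly_monoid_morphism : monoid_morphism R3_poly.
Proof.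
split=> [|p q]; apply/val_inj; first by rewrite rmorph1 /= tofrac1.
by rewrite rmorphM /= tofracM.
Qed.
HB.instance Definition _ :=
  GRing.isZmodMorphism.Build _ _ R3_poly R3_poly_zmod_morphism.
HB.instance Definition _ :=
  GRing.isMonoidMorphism.Build _ _ R3_poly R3_poly_monoid_morphism.

Lemma R3_poly_inj : injective R3_poly.
Proof. by move=> p q /(congr1 val)/eqP; rewrite /= tofrac_eq => /eqP. Qed.

Definition R3_t : R3 := R3_poly 'X.

Lemma R3_polyE p : R3_poly p = (map_poly intr p).[R3_t].
Proof.
elim/poly_ind: p => [|p c IH]; first by rewrite !rmorph0 horner0.
rewrite rmorphD rmorphM /= IH rmorphD rmorphM /= map_polyX map_polyC /=.
by rewrite !hornerE; congr (_ + _); rewrite -[c in LHS]intz !rmorph_int.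
Qed.

Definition is_den (d : {poly int}) := exists m n, d = R3_den m n.

Lemma is_den1 : is_den 1. Proof. by exists 0, 0; rewrite R3_den0. Qed.
Lemma is_denM d d' : is_den d -> is_den d' -> is_den (d * d').
Proof.
by move=> [m [n ->]] [m' [n' ->]]; exists (m + m')%N, (n + n')%N; rewrite R3_denD.
Qed.

Lemma R3_fracP (x : R3) :
  exists pd : {poly int} * {poly int},
    is_den pd.2 /\ x * R3_poly pd.2 = R3_poly pd.1.
Proof.
have /asboolP[p [m [n xE]]] := valP x; exists (p, R3_den m n).
split; first by exists m, n.
apply/val_inj; apply: etrans (subring_valM _ _) _.
rewrite (xE : subring_val x = _) /=; exact/divfK/tofrac_den_neq0.
Qed.

Lemma R3_den_unit d : is_den d -> R3_poly d \is a GRing.unit.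
Proof.
move=> [m [n ->]]; apply/subring_unitP; split; first exact: tofrac_den_neq0.
by apply/asboolP; exists 1, m, n; rewrite tofrac1 div1r.
Qed.

Lemma R3_tD_unit1 : R3_t + l1%:~R \is a GRing.unit.
Proof.
have := @R3_den_unit (R3_den 1 0) (ex_intro _ _ (ex_intro _ _ erefl)).
rewrite /R3_den expr0 expr1 mulr1.
by rewrite R3_polyE rmorphD /= map_polyX map_polyC /= !hornerE.
Qed.
Lemma R3_tD_unit2 : R3_t + l2%:~R \is a GRing.unit.
Proof.
have := @R3_den_unit (R3_den 0 1) (ex_intro _ _ (ex_intro _ _ erefl)).
rewrite /R3_den expr0 expr1 mul1r.
by rewrite R3_polyE rmorphD /= map_polyX map_polyC /= !hornerE.
Qed.

Lemma R3_morph_eq (A : comUnitRingType) (f g : {rmorphism R3 -> A}) :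
  f R3_t = g R3_t -> f =1 g.
Proof.
move=> fg x; have polyE p : f (R3_poly p) = g (R3_poly p).
  rewrite R3_polyE -!horner_map fg /=; congr (_.[_]).
  by rewrite -!map_poly_comp; apply: eq_map_poly => c /=; rewrite !rmorph_int.
have [[p d] [/= dd xE]] := R3_fracP x.
have ud := rmorph_unit g (R3_den_unit dd).
apply: (mulIr ud); rewrite -rmorphM /= -polyE -rmorphM /= xE.
exact: polyE.
Qed.

Section Eval.
Variables (A : comUnitRingType) (tau : A).
Hypothesis u1 : tau + l1%:~R \is a GRing.unit.
Hypothesis u2 : tau + l2%:~R \is a GRing.unit.

Let ev (p : {poly int}) : A := (map_poly intr p).[tau].

Let evM p q : ev (p * q) = ev p * ev q.
Proof. by rewrite /ev rmorphM hornerM. Qed.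
Let evB p q : ev (p - q) = ev p - ev q.
Proof. by rewrite /ev rmorphB !hornerE. Qed.
Let ev1 : ev 1 = 1.
Proof. by rewrite /ev rmorph1 hornerE. Qed.

Let ev_den d : is_den d -> ev d \is a GRing.unit.
Proof.
move=> [m [n ->]].
rewrite /ev /R3_den rmorphM !rmorphXn /= !rmorphD /= !map_polyX !map_polyC /=.
by rewrite hornerM !horner_exp !hornerE unitrM !unitrX.
Qed.

Let ev_val (x : R3) : A :=
  ev (sval (cid (R3_fracP x))).1 / ev (sval (cid (R3_fracP x))).2.

Let ev_valE x p d : is_den d ->
  x * R3_poly d = R3_poly p -> ev_val x = ev p / ev d.
Proof.
move=> dd xp; rewrite /ev_val; case: (cid _) => -[q d'] [/= dd' xq].
apply: (mulIr (ev_den dd')); rewrite divrK ?ev_den //.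
apply: (mulIr (ev_den dd)); rewrite mulrAC divrK ?ev_den // -!evM; congr ev.
by apply: R3_poly_inj; rewrite !rmorphM /= -xp -xq mulrAC.
Qed.

Fact R3_eval_ex : exists f : {rmorphism R3 -> A}, f R3_t = tau.
Proof.
have zm : zmod_morphism ev_val.
  move=> x y; have [[p d] [/= dd xE]] := R3_fracP x.
  have [[q d'] [/= dd' yE]] := R3_fracP y.
  rewrite (ev_valE dd xE) (ev_valE dd' yE).
  rewrite (@ev_valE _ (p * d' - q * d) _ (is_denM dd dd')).
    rewrite evB !evM invrM ?ev_den // mulrBl; congr (_ - _).
      by rewrite mulrA mulrK ?ev_den.
    by rewrite mulrACA divrr ?ev_den // mulr1.
  rewrite !rmorphB /= !rmorphM /= -xE -yE mulrBl.
  by congr (_ - _); rewrite ?mulrA // mulrAC.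
have mm : monoid_morphism ev_val.
  split=> [|x y].
    rewrite (@ev_valE 1 1 1 is_den1) ?ev1 ?divr1 //.
    by rewrite rmorph1 mulr1.
  have [[p d] [/= dd xE]] := R3_fracP x.
  have [[q d'] [/= dd' yE]] := R3_fracP y.
  rewrite (ev_valE dd xE) (ev_valE dd' yE).
  rewrite (@ev_valE _ (p * q) _ (is_denM dd dd')).
    by rewrite !evM invrM ?ev_den // [RHS]mulrACA [X in _ = _ * X]mulrC.
  by rewrite !rmorphM /= -xE -yE mulrACA.
pose Fz := GRing.isZmodMorphism.Build _ _ ev_val zm.
pose Fm := GRing.isMonoidMorphism.Build _ _ ev_val mm.
pose f : {rmorphism R3 -> A} := HB.pack ev_val Fz Fm.
exists f => /=; rewrite (@ev_valE R3_t 'X 1 is_den1).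
  by rewrite ev1 divr1 /ev map_polyX hornerX.
by rewrite rmorph1 mulr1.
Qed.
End Eval.

End R3.

Section LaurentMonomials.
Variables (A : comUnitRingType) (x y : A).
Hypotheses (ux : x \is a GRing.unit) (uy : y \is a GRing.unit).

Definition laurent (v : 'cV[int]_2) : A := x ^ v 0 0 * y ^ v 1 0.

Lemma laurent_unit v : laurent v \is a GRing.unit.
Proof. by rewrite unitrM !unitrXz. Qed.
Lemma laurent0 : laurent 0 = 1.
Proof. by rewrite /laurent !mxE !expr0z mulr1. Qed.
Lemma laurentD v w : laurent (v + w) = laurent v * laurent w.
Proof. by rewrite /laurent !mxE !exprzDr // mulrACA. Qed.
Lemma laurentN v : laurent (- v) = (laurent v)^-1.
Proof.
apply: (mulrI (laurent_unit v)); rewrite divrr ?laurent_unit //.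
by rewrite -laurentD subrr laurent0.
Qed.
Lemma laurentZ k v : laurent (k *: v) = laurent v ^ k.
Proof.
have exprzM (a c : A) : a \is a GRing.unit -> c \is a GRing.unit ->
    (a * c) ^ k = a ^ k * c ^ k.
  move=> ua uc; case: k => n; first exact: exprMn.
  rewrite NegzE -!invr_expz -!exprnP exprMn invrM ?unitrX //.
  exact: mulrC.
rewrite /laurent !mxE exprzM ?unitrXz //.
by rewrite !exprz_exp ![k * _]mulrC.
Qed.
Lemma laurent_e0 : laurent (col 0 1%:M) = x.
Proof. by rewrite /laurent !mxE /= expr1z expr0z mulr1. Qed.
Lemma laurent_e1 : laurent (col 1 1%:M) = y.
Proof. by rewrite /laurent !mxE /= expr1z expr0z mul1r. Qed.

Lemma laurent_morph (f : {rmorphism A -> A}) (b : 'M[int]_2) :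
  f x = laurent (col 0 b) -> f y = laurent (col 1 b) ->
  forall v, f (laurent v) = laurent (b *m v).
Proof.
move=> f0 f1 v.
rewrite {1}/laurent rmorphM !rmorphXz //=.
rewrite f0 f1 -!laurentZ -laurentD; congr laurent.
apply/matrixP => i j; rewrite ord1 !mxE big_ord_recr big_ord1 /=.
rewrite mulrC [X in _ + X]mulrC.
by congr (b _ _ * v _ _ + b _ _ * v _ _); apply/val_inj.
Qed.

End LaurentMonomials.

Definition mx22 (a b c d : int) : 'M[int]_2 :=
  \matrix_(i, j) nth 0 (nth [::] [:: [:: a; b]; [:: c; d]] i) j.

Definition K_gen (l2 : int) : 'M[int]_2 :=
  if l2 == 1 then mx22 (-1) (-1) 0 1 else mx22 1 0 (-1) (-1).

Lemma mx22M a b c d a' b' c' d' :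
  mx22 a b c d * mx22 a' b' c' d' =
  mx22 (a * a' + b * c') (a * b' + b * d') (c * a' + d * c') (c * b' + d * d').
Proof.
apply/matrixP => i j; rewrite !mxE big_ord_recr big_ord1 /= !mxE /=.
by case: i => [[|[|]]] //= ?; case: j => [[|[|]]].
Qed.
Lemma mx22_1 : mx22 1 0 0 1 = 1.
Proof.
by apply/matrixP => i j; rewrite !mxE; case: i => [[|[|]]] //= ?;
  case: j => [[|[|]]].
Qed.

Lemma K_gen2 l2 : K_gen l2 * K_gen l2 = 1.
Proof. by rewrite /K_gen -mx22_1; case: eqP => _; rewrite mx22M. Qed.

Lemma laurent_K_gen (A : comUnitRingType) (l2 : int) (x : A) :
  l2 \in [:: 1; -1] ->
  x \is a GRing.unit -> x + l2%:~R \is a GRing.unit ->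
  laurent x (x + l2%:~R) (col 0 (K_gen l2)) + l2%:~R =
  laurent x (x + l2%:~R) (col 1 (K_gen l2)).
Proof.
rewrite !inE => /orP[]/eqP-> /= ux uy.
  rewrite /laurent !mxE /= expr0z expr1z mulr1 exprN1.
  by rewrite mulrDr mulVr // mulr1 addrC.
rewrite /laurent !mxE /= expr0z expr1z mul1r exprN1; apply: (mulIr uy).
rewrite mulrDl divrK // mulVr // mulrN1z mulN1r opprD opprK.
by rewrite addrA subrr add0r.
Qed.

Section Action.
Variable l2 : int.

Local Notation R := (R3 0 l2).
Local Notation t := (R3_t 0 l2).

Lemma R3_t_unit : t \is a GRing.unit.
Proof. by have := R3_tD_unit1 0 l2; rewrite addr0. Qed.
Lemma R3_tl_unit : t + l2%:~R \is a GRing.unit.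
Proof. exact: R3_tD_unit2. Qed.

Definition monomial (v : 'cV[int]_2) : R := laurent t (t + l2%:~R) v.

Lemma monomial_unit v : monomial v \is a GRing.unit.
Proof. exact: laurent_unit R3_t_unit R3_tl_unit v. Qed.
Lemma monomial0 : monomial 0 = 1.
Proof. exact: laurent0. Qed.
Lemma monomialD v w : monomial (v + w) = monomial v * monomial w.
Proof. exact: laurentD R3_t_unit R3_tl_unit v w. Qed.
Lemma monomialN v : monomial (- v) = (monomial v)^-1.
Proof. exact: laurentN R3_t_unit R3_tl_unit v. Qed.

Definition monomial_pred : {pred unitg R} :=
  fun u => `[< exists v, uval u = monomial v >].

Fact monomial_closed : group_closed monomial_pred.
Proof.
split=> [|x y /asboolP[v xE] /asboolP[w yE]]; apply/asboolP.
  by exists 0; rewrite monomial0.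
by exists (v - w); rewrite monomialD monomialN -xE -yE.
Qed.
Fact monomial_conj x y : x \in monomial_pred -> (x ^ y)%g \in monomial_pred.
Proof.
suff -> : (x ^ y)%g = x by [].
apply: uval_inj; rewrite /conjg !uvalM uvalV mulrCA mulrC mulVr ?mul1r //.
exact: uvalP.
Qed.

Definition monomial_group : normal_subgroup (unitg R) :=
  NormalSubgroup monomial_closed monomial_conj.

Definition K_pred : {pred unitg 'M[int]_2} :=
  fun b => (uval b == 1) || (uval b == K_gen l2).

Fact K_closed : group_closed K_pred.
Proof.
have inv1 (b : unitg 'M[int]_2) : b \in K_pred ->
    uval (b^-1)%g = uval b.
  move=> Kb; rewrite uvalV; apply: (mulrI (uvalP b)).
  rewrite divrr ?uvalP //.
  by case/orP: Kb => /eqP->; rewrite ?mulr1 ?K_gen2.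
split=> [|x y Kx Ky]; rewrite unfold_in ?eqxx // uvalM inv1 //.
case/orP: Kx => /eqP->; case/orP: Ky => /eqP->.
- by rewrite mulr1 eqxx.
- by rewrite mul1r eqxx orbT.
- by rewrite mulr1 eqxx orbT.
- by rewrite K_gen2 eqxx.
Qed.

Record K_group := MkK { K_val :> unitg 'M[int]_2; _ : K_val \in K_pred }.
HB.instance Definition _ := [isSub for K_val].
HB.instance Definition _ := [Choice of K_group by <:].
HB.instance Definition _ := SubChoice_isSubGroup.Build _ _ K_group K_closed.

(* Matrices act on column vectors, so the columns of [K_mx b] are the images of
   the standard basis vectors. *)
Definition K_mx (b : K_group) : 'M[int]_2 := uval (K_val b).

Lemma K_mx1 : K_mx 1%g = 1. Proof. by []. Qed.
Lemma K_mxM b c : K_mx (b * c)%g = K_mx b * K_mx c. Proof. by []. Qed.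

Hypothesis l2P : l2 \in [:: 1; -1].

Definition ring_act_spec (b : 'M[int]_2) (f : R -> R) :=
  forall v, f (monomial v) = monomial (b *m v).

Lemma K_gen_image :
  monomial (col 0 (K_gen l2)) + l2%:~R = monomial (col 1 (K_gen l2)).
Proof. exact: laurent_K_gen l2P R3_t_unit R3_tl_unit. Qed.

Fact ring_act_ex (b : K_group) :
  exists f : {rmorphism R -> R}, ring_act_spec (K_mx b) f.
Proof.
suff [f [f0 f1]] : exists f : {rmorphism R -> R},
    f t = monomial (col 0 (K_mx b)) /\ f (t + l2%:~R) = monomial (col 1 (K_mx b)).
  by exists f => v; apply: (laurent_morph R3_t_unit R3_tl_unit f0 f1).
have /orP[/eqP bE|/eqP bE] := valP b; rewrite /K_mx bE.
  by exists idfun; rewrite /= /monomial laurent_e0 laurent_e1.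
have u1 : monomial (col 0 (K_gen l2)) + 0%:~R \is a GRing.unit.
  by rewrite addr0 monomial_unit.
have u2 : monomial (col 0 (K_gen l2)) + l2%:~R \is a GRing.unit.
  by rewrite K_gen_image monomial_unit.
have [f ft] := R3_eval_ex u1 u2.
exists f; split => //; rewrite -K_gen_image -ft rmorphD; congr (_ + _).
exact: rmorph_int.
Qed.

(* The choice is harmless: such an endomorphism is unique by [R3_endo_eq]. *)
Definition ring_act (b : K_group) : {rmorphism R -> R} :=
  sval (cid (ring_act_ex b)).

Lemma ring_actE b v : ring_act b (monomial v) = monomial (K_mx b *m v).
Proof. exact: (svalP (cid (ring_act_ex b))). Qed.

Lemma R3_endo_eq (f g : {rmorphism R -> R}) :
  (forall v, f (monomial v) = g (monomial v)) -> f =1 g.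
Proof.
move=> fg; apply: R3_morph_eq.
by rewrite -(laurent_e0 t (t + l2%:~R)).
Qed.

Lemma ring_act1 : ring_act 1%g =1 id.
Proof.
apply: (R3_endo_eq (g := idfun)) => v.
by rewrite ring_actE K_mx1 mul1mx.
Qed.
Lemma ring_actM b c x : ring_act (b * c)%g x = ring_act b (ring_act c x).
Proof.
apply: (R3_endo_eq (g := ring_act b \o ring_act c)) => v /=.
by rewrite !ring_actE K_mxM mulmxA.
Qed.

Definition unit_act (b : K_group) (u : unitg R) : unitg R :=
  Unitg (rmorph_unit (ring_act b) (uvalP u)).

Lemma unit_actM b : {morph unit_act b : u v / (u * v)%g}.
Proof. by move=> u v; apply: uval_inj; rewrite /= rmorphM. Qed.

Lemma unit_act_M b u : u \in monomial_group -> unit_act b u \in monomial_group.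
Proof.
move=> /asboolP[v uE]; apply/asboolP; exists (K_mx b *m v).
by rewrite /= uE ring_actE.
Qed.

Local Notation UmodM := (quotg (unitg R) monomial_group).

Definition quot_act (b : K_group) (q : UmodM) : UmodM :=
  cosetg monomial_group (unit_act b (repr q)).

Lemma quot_actE b u :
  quot_act b (cosetg monomial_group u) = cosetg monomial_group (unit_act b u).
Proof.
apply/cosetgP; set u' := repr _.
have: (u'^-1 * u)%g \in monomial_group by apply/cosetgP; rewrite cosetg_repr.
move=> /(unit_act_M b); rewrite unit_actM.
suff -> : unit_act b u'^-1%g = (unit_act b u')^-1%g by [].
by apply: uval_inj; rewrite /= rmorphV ?uvalP.
Qed.

Fact quot_act_morph b : {morph quot_act b : p q / (p * q)%g}.
Proof.
move=> p q; rewrite -(cosetg_repr p) -(cosetg_repr q) -cosetgM.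
by rewrite !quot_actE unit_actM cosetgM.
Qed.

Fact quot_act1 : quot_act 1%g =1 id.
Proof.
move=> p; rewrite -(cosetg_repr p) quot_actE; congr cosetg.
by apply: uval_inj; rewrite /= ring_act1.
Qed.
Fact quot_act_comp b c p : quot_act (b * c)%g p = quot_act b (quot_act c p).
Proof.
rewrite -(cosetg_repr p) !quot_actE; congr cosetg.
by apply: uval_inj; rewrite /= ring_actM.
Qed.

Fact quot_act_bij b : bijective (quot_act b).
Proof.
exists (quot_act b^-1%g) => p; rewrite -quot_act_comp.
  by rewrite mulVg quot_act1.
by rewrite mulgV quot_act1.
Qed.

Definition K_act (b : K_group) : autg UmodM :=
  Autg (quot_act_morph b) (quot_act_bij b).

Fact K_act_morph : {morph K_act : b c / (b * c)%g}.
Proof. by move=> b c; apply: autg_ext => p; rewrite /= quot_act_comp. Qed.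

HB.instance Definition _ :=
  isMultiplicative.Build K_group (autg UmodM) K_act K_act_morph.

End Action.

(* Main.v *)
From HB Require Import structures.
Require Import Defs.
From mathcomp Require Import all_boot all_order all_algebra.
From mathcomp Require Import boolp zify ring lra.

(** Write R for the ring Z[t, 1/t, 1/(t + l2)], and x^v for the monomial
    t^v_0 (t + l2)^v_1.

    The group BMG is the semidirect product G of R by Z^2, where v acts as
    multiplication by x^v ([BMG_affineg]).  One of the two letters s, t of the
    presentation acts as t and the other as t + l2, in the order that turns
    a a^s = a^t into the identity 1 + s = t of R.  The point that needs an
    argument is that the single relation [a, a^t] = 1 makes all conjugates of a
    under <s, t> commute ([commute_conja]).  Granting it, the normal closure of
    a is a module over Z[s], and every h in BMG satisfies
    s^m t^n h = E(p) s^m' t^n' with E(p) the image of a polynomial p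
    ([normal_formP]); the image of this equation in G determines p, m' - m and
    n' - n, so BMG -> G is injective.

    Some 1 - x^w is a unit of R.  Hence R is the derived subgroup of G, every
    automorphism f of G preserves it, and f induces a map b on Z^2.  Comparing
    f(x^v) with f(1) = u shows that u is a unit and that f / u is the additive
    map x^v |-> x^(b v) on R, a ring automorphism.  It maps the identity
    x^(1,0) + l2 = x^(0,1) to a unit equation x^v + l2 = x^w, where v and w are
    the columns of b, and the only solutions are given by the two matrices of K
    ([monomial_unit_equation]).  So f determines a pair (u, b)
    ([aut_spec_ex]); pairs multiply by (u, b)(u', b') = (u b(u'), b b'), and
    every pair occurs.  Finally f is inner exactly when b = 1 and u is a
    monomial ([inner_spec]): what is left of such an f after a conjugation by a
    monomial is a 1-cocycle Z^2 -> R, which is a coboundary because some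
    1 - x^w is a unit.  The pairs modulo the monomials form the semidirect
    product of the statement. *)

Import GRing.Theory Num.Theory.

(** * Isomorphisms of groups *)

Lemma isogg_inj_surj (G H : groupType) (f : G -> H) :
  {morph f : x y / (x * y)%g} -> (forall x, f x = 1%g -> x = 1%g) ->
  (forall y, exists x, f x = y) -> isogg G H.
Proof.
move=> fM f1 fS.
pose M := isMultiplicative.Build G H f fM.
pose F : {multiplicative G -> H} := HB.pack f M.
have FI : injective f.
  move=> x y fxy; apply: (mulIg y^-1%g); rewrite mulgV; apply: f1.
  by rewrite fM fxy -fM mulgV; apply: (gmulf1g F).
exists F; exists (fun y => sval (cid (fS y))) => x /=; last exact: svalP (cid (fS x)).
by apply: FI; apply: svalP (cid (fS (f x))).
Qed.

Lemma isogg_trans (G H K : groupType) : isogg G H -> isogg H K -> isogg G K.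
Proof.
move=> [f fB] [g gB].
have [f' _ f'K] := fB; have [g' _ g'K] := gB.
apply: (@isogg_inj_surj _ _ (g \o f)) => [x y|x|y] /=.
- by rewrite !gmulfM.
- rewrite -(gmulf1g g) => /(bij_inj gB); rewrite -(gmulf1g f).
  exact: (bij_inj fB).
- by exists (f' (g' y)); rewrite f'K g'K.
Qed.

(** This is the first isomorphism theorem, with the kernel given as a membership
    condition rather than as a subgroup built from [f]. *)
Lemma quotg_isogg (G H : groupType) (N : normal_subgroup G) (f : G -> H) :
  {morph f : x y / (x * y)%g} -> (forall x, (f x = 1%g) <-> (x \in N)) ->
  (forall y, exists x, f x = y) -> isogg (quotg G N) H.
Proof.
move=> fM fN fS.
pose M := isMultiplicative.Build G H f fM.
pose F : {multiplicative G -> H} := HB.pack f M.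
have fE x : f (repr (cosetg N x)) = f x.
  have /cosetgP/fN := cosetg_repr (cosetg N x).
  rewrite fM => h; apply: (mulgI (f (repr (cosetg N x)))^-1%g).
  rewrite mulVg -h; congr (_ * _)%g; apply: (mulgI (f (repr (cosetg N x)))).
  by rewrite mulgV -fM mulgV; exact: (gmulf1g F).
apply: (@isogg_inj_surj (quotg G N) H (fun q : quotg G N => f (repr q))) => [p q|q|y].
- by rewrite -{1}(cosetg_repr p) -{1}(cosetg_repr q) -cosetgM fE fM.
- move=> /fN; rewrite -{2}(cosetg_repr q) => h; apply/cosetgP.
  by rewrite mulg1; apply: nsgV.
- by have [x <-] := fS y; exists (cosetg N x).
Qed.

Lemma Out_isogg (G H : groupType) : isogg G H -> isogg (Out G) (Out H).
Proof.
move=> [f [g fK gK]].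
have gM : {morph g : x y / (x * y)%g}.
  by move=> x y; apply: (can_inj fK); rewrite gmulfM !gK.
have TM (p : autg G) : {morph f \o p \o g : x y / (x * y)%g}.
  by move=> x y /=; rewrite gM autgM gmulfM.
have TB (p : autg G) : bijective (f \o p \o g).
  apply: bij_comp; last by exists f.
  by apply: bij_comp; [exists g | exact: autg_bij].
pose T p : autg H := Autg (TM p) (TB p).
have cE x y : f (x * y * x^-1)%g = (f x * f y * (f x)^-1)%g.
  by apply: (mulIg (f x)); rewrite -gmulfM !mulgVK gmulfM.
apply: (@quotg_isogg _ _ _ (fun p => cosetg (Inn H) (T p))) => [p q|p|q].
- rewrite -cosetgM; congr cosetg; apply: autg_ext => x /=.
  by rewrite fK.
- split=> [/esym/cosetgP|].
    rewrite invg1 mul1g => /asboolP[h hE]; apply/asboolP; exists (g h) => x.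
    by apply: (can_inj fK); rewrite cE gK -hE /= fK.
  move=> /asboolP[h hE]; apply/esym/cosetgP; rewrite invg1 mul1g.
  by apply/asboolP; exists (f h) => x; rewrite /= hE cE gK.
- have SM (p : autg H) : {morph g \o p \o f : x y / (x * y)%g}.
    by move=> x y /=; rewrite gmulfM autgM gM.
  have SB (p : autg H) : bijective (g \o p \o f).
    apply: bij_comp; last by exists g.
    by apply: bij_comp; [exists f | exact: autg_bij].
  exists (Autg (SM (repr q)) (SB (repr q))).
  rewrite -[RHS]cosetg_repr; congr cosetg; apply: autg_ext => x /=.
  by rewrite !gK.
Qed.

Lemma autg_conj (H : groupType) (f : autg H) x y :
  f (x * y * x^-1)%g = (f x * f y * (f x)^-1)%g.
Proof. by apply: (mulIg (f x)); rewrite -autgM !mulgVK autgM. Qed.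

Lemma commuteV2 (G : groupType) (x y : G) : commute x y -> commute x^-1%g y^-1%g.
Proof. by move=> xy; apply/commuteV/commute_sym/commuteV/commute_sym. Qed.

(** * Presented groups *)

Section PresentedGroups.
Variables (X : choiceType) (rels : seq (word X * word X)).
Local Open Scope group_scope.

Lemma presg_ind (P : presg rels -> Prop) :
  P 1 -> (forall x b q, P q -> P (wordg rels [:: (x, b)] * q)) -> forall q, P q.
Proof.
move=> P1 PM q; rewrite -(wordg_repr q).
by elim: (repr q) => [|[x b] w IH] //; rewrite -cat1s wordgM; apply: PM.
Qed.

Lemma wordgV w : wordg rels (inv_word w) = (wordg rels w)^-1.
Proof. by rewrite -pres_invE. Qed.

Lemma wordg_rel r : r \in rels -> wordg rels r.1 = wordg rels r.2.
Proof.
by move=> rr; apply/wordgP; have := pres_rel [::] [::] rr; rewrite !cats0.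
Qed.

Variables (H : groupType) (g : X -> H).

Definition word_eval (w : word X) : H :=
  foldr (fun l h => (if l.2 then g l.1 else (g l.1)^-1) * h) 1 w.

Lemma word_eval_cat u v : word_eval (u ++ v) = word_eval u * word_eval v.
Proof. by elim: u => [|l u IH] /=; rewrite ?mul1g // IH mulgA. Qed.

Lemma word_eval_letter x b : word_eval [:: (x, b)] = if b then g x else (g x)^-1.
Proof. by rewrite /= mulg1. Qed.

Lemma word_eval_inv w : word_eval (inv_word w) = (word_eval w)^-1.
Proof.
elim: w => [|[x b] w IH]; first by rewrite invg1.
rewrite -cat1s inv_word_cat !word_eval_cat invgM IH !word_eval_letter /=.
by case: b; rewrite ?invgK.
Qed.

(** The universal property of a presentation (von Dyck). *)
Lemma presg_lift : {in rels, forall r, word_eval r.1 = word_eval r.2} ->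
  exists2 f : presg rels -> H, {morph f : x y / x * y} &
    forall w, f (wordg rels w) = word_eval w.
Proof.
move=> gr.
have ev u v : pres_eqv rels u v -> word_eval u = word_eval v.
  elim=> {u v} // [u v w _ -> _ -> //|u v x b|u v r rr].
    rewrite !word_eval_cat; congr (_ * _); rewrite /= mulg1.
    by case: b; rewrite ?mulgV ?mulVg mul1g.
  by rewrite !word_eval_cat gr.
have fE w : word_eval (repr (wordg rels w)) = word_eval w.
  by apply/ev/wordgP; rewrite wordg_repr.
exists (fun q => word_eval (repr q)) => // p q.
by rewrite -{1}(wordg_repr p) -{1}(wordg_repr q) -wordgM fE word_eval_cat.
Qed.

End PresentedGroups.
Arguments word_eval {X H}.

(** * Commuting conjugates *)

Section CommutingConjugates.
Variable H : groupType.
Local Open Scope group_scope.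

Lemma commuteJ (x y g : H) : commute (x ^ g) (y ^ g) <-> commute x y.
Proof.
rewrite /commute -!conjMg; split=> [|-> //].
exact: conjg_inj.
Qed.

Variables a s t : H.
Hypothesis st : commute s t.
Hypothesis a_at : commute a (a ^ t).
Hypothesis aas : a * a ^ s = a ^ t.

Definition conja i j := a ^ (s ^+ i * t ^+ j).

Lemma conja_s i j : conja i j ^ s = conja i.+1 j.
Proof.
by rewrite /conja -conjgM -mulgA -(commuteX j st) mulgA -expgSr.
Qed.

Lemma conja_t i j : conja i j ^ t = conja i j.+1.
Proof. by rewrite /conja -conjgM -mulgA -expgSr. Qed.

Lemma conja00 : conja 0 0 = a.
Proof. by rewrite /conja !expg0 mulg1 conjg1. Qed.

Lemma conja_shift i j k l : conja (i + k) (j + l) = conja i j ^ (s ^+ k * t ^+ l).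
Proof.
elim: k => [|k IH] in i *.
  rewrite addn0 expg0 mul1g; elim: l => [|l IH] in j *.
    by rewrite addn0 conjg1.
  by rewrite expgS conjgM conja_t -IH addSnnS.
by rewrite expgS -mulgA conjgM conja_s -IH addSnnS.
Qed.

(** The defining relation, conjugated: in additive notation the exponent of [t]
    is lowered by t = 1 + s, so that every conjugate is a product of conjugates
    by powers of [s] alone. *)
Lemma conja_mul i j : conja i j * conja i.+1 j = conja i j.+1.
Proof.
rewrite -[i in LHS]add0n -[i.+1]add1n -[j in LHS]add0n -[i in RHS]add0n -[j.+1]add1n.
by rewrite !conja_shift -conjMg -conja_s -conja_t conja00 aas.
Qed.

(** Induction on [n], for all pairs of exponents at distance at most [n]: the
    relation [a, a^(s^n)] = 1, conjugated by [t], reads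
    [a a^s, a^(s^n) a^(s^(n+1))] = 1.  All pairs of factors commute by
    induction except for [a] and a^(s^(n+1)), which must then commute too. *)
Lemma commute_conja_row n : commute a (conja n 0).
Proof.
have shift i n' : commute a (conja n' 0) -> commute (conja i 0) (conja (n' + i) 0).
  move=> an; rewrite -[i in conja i _]add0n -[X in conja _ X]addn0.
  by rewrite -[X in commute _ (conja _ X)]addn0 !conja_shift conja00 commuteJ.
elim/ltn_ind: n => -[|[|n]] IH; first by rewrite conja00.
  have -> : conja 1 0 = a^-1 * conja 0 1.
    by rewrite -conja_mul conja00 mulKg.
  apply: commuteM; first exact: commuteV.
  by rewrite -conja_t conja00.
(* The three commutations known by induction; [c] below is the conjugate by
   [t] of the one for n + 1. *)
have c0 : commute a (conja n.+1 0) by apply: IH.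
have c1 : commute (conja 1 0) (conja n.+1 0).
  by have := shift 1%N n; rewrite addn1; apply; apply: IH.
have c2 : commute (conja 1 0) (conja n.+2 0).
  by have := shift 1%N n.+1; rewrite addn1; apply; apply: IH.
have : commute (a * conja 1 0) (conja n.+1 0 * conja n.+2 0).
  rewrite -{1}conja00 !conja_mul -!conja_t commuteJ conja00.
  exact: IH.
move=> c; have {}c : commute (a * conja 1 0) (conja n.+2 0).
  rewrite -[conja n.+2 0](mulKg (conja n.+1 0)); apply: commuteM => //.
  apply/commuteV/commute_sym/commuteM; exact: commute_sym.
have -> : a = a * conja 1 0 * (conja 1 0)^-1 by rewrite mulgK.
apply/commute_sym/commuteM; first exact: commute_sym.
exact/commuteV/commute_sym.
Qed.

Lemma commute_conja i j k l : commute (conja i j) (conja k l).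
Proof.
have row i' k' : commute (conja i' 0) (conja k' 0).
  wlog le_ik : i' k' / (i' <= k')%N.
    by move=> h; case/orP: (leq_total i' k') => ?; [|apply: commute_sym]; apply: h.
  rewrite -(subnK le_ik) -[i' in conja i' _]add0n -[X in conja _ X]addn0.
  rewrite -[X in commute _ (conja _ X)]addn0 !conja_shift conja00 commuteJ.
  exact: commute_conja_row.
have grid i' j' k' : commute (conja k' 0) (conja i' j').
  elim: j' => [|j' IH] in i' *; first exact: row.
  by rewrite -conja_mul; apply: commuteM.
wlog le_jl : i j k l / (j <= l)%N.
  by move=> h; case/orP: (leq_total j l) => ?; [|apply: commute_sym]; apply: h.
rewrite -(subnK le_jl) -[j in conja _ j]add0n -[i]addn0 -[k]addn0.
by rewrite !conja_shift commuteJ.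
Qed.

(** The second centralizer of the conjugates.  It contains the subgroup that they
    generate, and it is abelian because they commute, but it needs no words or
    products to describe. *)
Definition conja_span (h : H) : Prop :=
  forall c, (forall i j, commute c (conja i j)) -> commute h c.

Lemma span_conja i j : conja_span (conja i j).
Proof. by move=> c; move/(_ i j)/commute_sym. Qed.

Lemma conja_span_comm g h : conja_span g -> conja_span h -> commute g h.
Proof.
move=> gS hS; apply: (gS) => i j; apply: hS => k l; exact: commute_conja.
Qed.

Lemma conja_span1 : conja_span 1.
Proof. by move=> c _; apply/commute_sym/commute1. Qed.

Lemma conja_spanM g h : conja_span g -> conja_span h -> conja_span (g * h).
Proof.
move=> gS hS c cS; apply/commute_sym/commuteM; apply/commute_sym.
  exact: gS.
exact: hS.
Qed.

Lemma conja_spanV g : conja_span g -> conja_span g^-1.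
Proof. by move=> gS c cS; apply/commute_sym/commuteV/commute_sym/gS. Qed.

Lemma conja_spanJ g x : conja_span g ->
  (forall i j, exists k l, conja i j ^ x = conja k l) -> conja_span (g ^ x).
Proof.
move=> gS xS c cS; rewrite -(conjgKV x c) commuteJ; apply: gS => i j.
have [k [l kl]] := xS i j.
by apply/(commuteJ _ _ x); rewrite conjgKV kl.
Qed.

Record spang := Spang { span_val : H; _ : `[< conja_span span_val >] }.
HB.instance Definition _ := [isSub for span_val].
HB.instance Definition _ := [Choice of spang by <:].

Lemma spangP (x : spang) : conja_span (span_val x).
Proof. exact/asboolP/(valP x). Qed.

Definition to_spang h (hS : conja_span h) : spang := Spang h (introT (asboolP _) hS).

Definition spang0 : spang := to_spang _ conja_span1.
Definition spang_add (x y : spang) : spang :=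
  to_spang _ (conja_spanM _ _ (spangP x) (spangP y)).
Definition spang_opp (x : spang) : spang := to_spang _ (conja_spanV _ (spangP x)).

Fact spang_addA : associative spang_add.
Proof. by move=> x y z; apply: val_inj; rewrite /= mulgA. Qed.
Fact spang_addC : commutative spang_add.
Proof.
by move=> x y; apply: val_inj; apply: conja_span_comm; apply: spangP.
Qed.
Fact spang_add0 : left_id spang0 spang_add.
Proof. by move=> x; apply: val_inj; rewrite /= mul1g. Qed.
Fact spang_addN : left_inverse spang0 spang_opp spang_add.
Proof. by move=> x; apply: val_inj; rewrite /= mulVg. Qed.
HB.instance Definition _ :=
  GRing.isZmodule.Build spang spang_addA spang_addC spang_add0 spang_addN.

Local Open Scope ring_scope.

Definition aspan i : spang := to_spang _ (span_conja i 0).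

(** The action of p(s) on [a], in the module that the conjugates of [a] generate. *)
Definition poly_span (p : {poly int}) : spang :=
  \sum_(i < size p) aspan i *~ p`_i.

Lemma poly_span_widen n (p : {poly int}) : (size p <= n)%N ->
  poly_span p = \sum_(i < n) aspan i *~ p`_i.
Proof.
move=> le_pn; rewrite /poly_span (big_ord_widen n (fun i => aspan i *~ p`_i)) //.
rewrite [RHS](bigID (fun i : 'I_n => i < size p)%N) /= [X in _ + X]big1 ?addr0 //.
by move=> i; rewrite -leqNgt => le_pi; rewrite nth_default // mulr0z.
Qed.

Lemma poly_spanB p q : poly_span (p - q) = poly_span p - poly_span q.
Proof.
pose n := maxn (size p) (size q).
have hp : (size p <= n)%N by apply: leq_maxl.
have hq : (size q <= n)%N by apply: leq_maxr.
have hpq : (size (p - q)%R <= n)%N.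
  by apply: leq_trans (size_polyD _ _) _; rewrite size_polyN.
rewrite !(@poly_span_widen n) // -sumrB; apply: eq_bigr => i _.
by rewrite coefB mulrzBr.
Qed.


Section SpanConj.
Variable x : H.
Hypothesis xS : forall i j, exists k l, (conja i j ^ x)%g = conja k l.

Definition span_conj (g : spang) : spang :=
  to_spang _ (conja_spanJ _ _ (spangP g) xS).

Lemma span_conjB : {morph span_conj : g h / g - h}.
Proof. by move=> g h; apply: val_inj; rewrite /= conjMg conjVg. Qed.

Lemma span_conj_poly p :
  span_conj (poly_span p) = \sum_(i < size p) span_conj (aspan i) *~ p`_i.
Proof.
pose F : {additive spang -> spang} :=
  HB.pack span_conj (GRing.isZmodMorphism.Build _ _ span_conj span_conjB).
rewrite -[LHS]/(F _) raddf_sum; apply: eq_bigr => i _.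
exact: raddfMz.
Qed.

End SpanConj.

Lemma conja_s_ex i j : exists k l, (conja i j ^ s)%g = conja k l.
Proof. by exists i.+1, j; apply: conja_s. Qed.

Lemma conja_t_ex i j : exists k l, (conja i j ^ t)%g = conja k l.
Proof. by exists i, j.+1; apply: conja_t. Qed.

Lemma poly_spanX p : poly_span ('X * p) = span_conj s conja_s_ex (poly_span p).
Proof.
rewrite span_conj_poly (@poly_span_widen (size p).+1).
  rewrite big_ord_recl coefXM mulr0z add0r; apply: eq_bigr => i _.
  rewrite coefXM; congr (_ *~ _); apply: val_inj.
  by rewrite /= conja_s.
have [->|p0] := eqVneq p 0; first by rewrite mulr0 size_poly0.
by rewrite mulrC size_mulX.
Qed.

Lemma poly_spanX1 p :
  poly_span (('X + 1) * p) = span_conj t conja_t_ex (poly_span p).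
Proof.
have -> : ('X + 1) * p = p - - ('X * p) by rewrite mulrDl mul1r opprK addrC.
rewrite !poly_spanB -[- ('X * p)]sub0r poly_spanB.
have -> : poly_span 0 = 0 by rewrite -(subrr 0) poly_spanB subrr.
rewrite sub0r opprK poly_spanX !span_conj_poly -big_split /=.
apply: eq_bigr => i _; rewrite -mulrzDl; congr (_ *~ _); apply: val_inj.
by rewrite /= conja_s conja_t conja_mul.
Qed.

(** The normal closure of [a] is a module over Z[X], with X acting as conjugation
    by [s] and X + 1 as conjugation by [t]. *)
Lemma poly_conj_ex : exists E : {poly int} -> H,
  [/\ E 1 = a, forall p q, E (p - q) = (E p / E q)%g,
      forall p, E ('X * p) = (E p ^ s)%g &
      forall p, E (('X + 1) * p) = (E p ^ t)%g].
Proof.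
exists (fun p => span_val (poly_span p)); split=> [|p q|p|p].
- by rewrite /poly_span size_poly1 big_ord1 coef1 /= conja00.
- by rewrite poly_spanB.
- by rewrite poly_spanX.
- by rewrite poly_spanX1.
Qed.

End CommutingConjugates.

Local Open Scope ring_scope.

(** * Monomials in the localized ring *)

Local Notation e i := (col i (1%:M : 'M[int]_2)).

Lemma intpoly_ind (P : {poly int} -> Prop) :
  P 1 -> (forall p q, P p -> P q -> P (p - q)) -> (forall p, P p -> P ('X * p)) ->
  forall p, P p.
Proof.
move=> P1 PB PX.
have P0 : P 0 by rewrite -(subrr 1); apply: PB.
have PN p : P p -> P (- p) by move=> Pp; rewrite -sub0r; apply: PB.
have PD p q : P p -> P q -> P (p + q).
  by move=> Pp Pq; rewrite -(opprK q); apply/PB/PN.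
have Pn (n : nat) : P n%:R.
  by elim: n => [|n IH] //; rewrite -natr1; apply: PD.
have Pc (c : int) : P c%:P.
  case: c => n; rewrite ?NegzE ?polyCN -natz polyC_natr; last exact: PN.
  exact: Pn.
by elim/poly_ind => // p c IH; apply: PD => //; rewrite mulrC; apply: PX.
Qed.

Section Ring.
Variable l2 : int.
Local Notation R := (R3 0 l2).
Local Notation t := (R3_t 0 l2).
Local Notation mono := (@monomial l2).

Lemma monomial_e0 : mono (e 0) = t.
Proof. exact: laurent_e0. Qed.

Lemma monomial_e1 : mono (e 1) = t + l2%:~R.
Proof. exact: laurent_e1. Qed.

Lemma monomialMn v n : mono (v *+ n) = mono v ^+ n.
Proof.
elim: n => [|n IH]; first by rewrite mulr0n monomial0 expr0.
by rewrite mulrS exprS monomialD IH.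
Qed.

Lemma R3_polyX : R3_poly 0 l2 'X = t.
Proof. by []. Qed.

Lemma R3_poly_XD : R3_poly 0 l2 ('X + l2%:P) = t + l2%:~R.
Proof.
by rewrite rmorphD /= -[l2 in l2%:P]intz !rmorph_int.
Qed.

(** The monomials span the ring additively, so an additive map on it is determined
    by its values on them. *)
Lemma R3_ind (P : R -> Prop) :
  (forall x y, P x -> P y -> P (x - y)) -> (forall v, P (mono v)) ->
  forall x, P x.
Proof.
move=> PB Pm x; have [[p d] [/= [m [n dE]] xE]] := R3_fracP x.
have dm : R3_poly 0 l2 d = mono (e 0 *+ m + e 1 *+ n).
  rewrite monomialD !monomialMn monomial_e0 monomial_e1 dE /R3_den.
  by rewrite rmorphM !rmorphXn /= R3_poly_XD addr0.
have -> : x = R3_poly 0 l2 p * mono (- (e 0 *+ m + e 1 *+ n)).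
  by rewrite -xE dm monomialN mulrK // monomial_unit.
move: (- _) => {x xE} w; elim/intpoly_ind: p w => [w|p q Pp Pq w|p Pp w].
- by rewrite rmorph1 mul1r.
- by rewrite rmorphB mulrBl; apply: PB.
- by rewrite rmorphM /= R3_polyX -monomial_e0 mulrAC mulrC -monomialD.
Qed.

Lemma R3_zmod_eq (V : zmodType) (f g : R -> V) :
  {morph f : x y / x - y} -> {morph g : x y / x - y} ->
  (forall v, f (mono v) = g (mono v)) -> f =1 g.
Proof.
move=> fB gB fg; apply: R3_ind => // x y fx fy.
by rewrite fB gB fx fy.
Qed.

End Ring.

Lemma cV2_eq (v w : 'cV[int]_2) : v 0 0 = w 0 0 -> v 1 0 = w 1 0 -> v = w.
Proof.
move=> h0 h1; apply/matrixP => i j; rewrite ord1.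
case: i => [[|[|//]]] i2.
  by rewrite (_ : Ordinal i2 = 0) //; apply: val_inj.
by rewrite (_ : Ordinal i2 = 1) //; apply: val_inj.
Qed.

Lemma int_mx_additive (B : 'cV[int]_2 -> 'cV[int]_2) (b : 'M[int]_2) :
  {morph B : v w / v + w} -> B (e 0) = col 0 b -> B (e 1) = col 1 b ->
  forall v, B v = b *m v.
Proof.
move=> BD B0 B1 v.
have Bsub : {morph B : x y / x - y}.
  by move=> x y; apply: (addIr (B y)); rewrite -BD !subrK.
pose F : {additive 'cV[int]_2 -> 'cV[int]_2} :=
  HB.pack B (GRing.isZmodMorphism.Build _ _ B Bsub).
have vE : v = e 0 *~ v 0 0 + e 1 *~ v 1 0.
  by apply: cV2_eq; rewrite !mxE -!scaler_int !mxE /=; lia.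
rewrite {1}vE -[B _]/(F _) raddfD !raddfMz /= B0 B1.
have l1 : lift ord0 ord0 = 1 :> 'I_2 by apply: val_inj.
apply: cV2_eq; rewrite -!scaler_int !mxE !big_ord_recl !big_ord0 /= l1 !intz addr0.
  by congr (_ + _); rewrite mulrC.
by congr (_ + _); rewrite mulrC.
Qed.

(** * The unit equation *)

(** Parity decides the equation: clearing a negative exponent, or having both
    exponents positive, makes the two sides of different parity. *)
Lemma odd_pow2 (c m : nat) (z : int) : odd c ->
  c%:R * 2 ^ z = 2 ^+ m + 1 :> rat ->
  (z = 0 /\ c = (2 ^ m).+1) \/ [/\ m = 0, c = 1 & z = 1]%N.
Proof.
move=> oc; case: z => k; last first.
  rewrite NegzE -exprnN => /(congr1 ( *%R^~ (2 ^+ k.+1))).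
  rewrite divfK ?expf_neq0 // -!natrX natr1 -natrM => /eqP; rewrite eqr_nat.
  by move=> /eqP cE; move: oc; rewrite cE oddM expnS oddM andbF.
rewrite -exprnP -!natrX -natrM natr1 => /eqP; rewrite eqr_nat => /eqP.
case: k => [|k]; first by rewrite muln1 => ->; left.
case: m => [|m] cE; last first.
  by have := congr1 odd cE; rewrite oddM !expnS !oddM /= oddM andbF.
right; have : (c * 2 ^ k = 1)%N by move: cE; rewrite expnS; lia.
move=> /eqP; rewrite muln_eq1 => /andP[/eqP-> /eqP].
by case: k {cE} => // k; rewrite expnS; lia.
Qed.

Lemma pow2_eq_succ (x y : int) : 2 ^ x = 2 ^ y + 1 :> rat -> x = 1 /\ y = 0.
Proof.
case: y => n.
  rewrite -exprnP => xE.
  have [|[_ /eqP]|[-> _ ->]//] := @odd_pow2 1 n x isT; rewrite ?mul1r //.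
  by rewrite eqSS eq_sym expn_eq0.
(* A negative y is cleared by multiplying the equation by 2^(-y). *)
rewrite NegzE -exprnN => xE.
have [|[_ /eqP]|[]//] := @odd_pow2 1 n.+1 (x + n.+1) isT.
  rewrite mul1r expfzDr // xE -exprnP mulrDl mulVf ?expf_neq0 //.
  by rewrite mul1r addrC.
by rewrite eqSS eq_sym expn_eq0.
Qed.

Lemma triple_pow2_eq_succ (x y : int) : 3 * 2 ^ x = 2 ^ y + 1 :> rat ->
  (x = 0 /\ y = 1) \/ (x = -1 /\ y = -1).
Proof.
have p2 n : 3 = (2 ^ n).+1 -> n = 1%N.
  by case: n => [|[|n]] //; rewrite !expnS; have := expn_gt0 2 n; lia.
case: y => n.
  rewrite -exprnP => xE.
  have [|[-> /p2->]|[]//] := @odd_pow2 3 n x isT; first by [].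
  by left.
rewrite NegzE -exprnN => xE.
have [|[xn /p2 n1]|[]//] := @odd_pow2 3 n.+1 (x + n.+1) isT.
  rewrite expfzDr // mulrA xE -exprnP mulrDl mulVf ?expf_neq0 //.
  by rewrite mul1r addrC.
by move: xn; rewrite n1 => /eqP; rewrite addr_eq0 => /eqP->; right.
Qed.

Lemma rmorph_laurent (A B : comUnitRingType) (f : {rmorphism A -> B}) x y v :
  x \is a GRing.unit -> y \is a GRing.unit ->
  f (laurent x y v) = laurent (f x) (f y) v.
Proof. by move=> ux uy; rewrite /laurent rmorphM /= !rmorphXz. Qed.

Section UnitEquation.
Variable l2 : int.
Hypothesis l2P : l2 \in [:: 1; -1].
Local Notation mono := (@monomial l2).

Lemma monomial_eval (q : rat) v w : q != 0 -> q + l2%:~R != 0 ->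
  mono v + l2%:~R = mono w ->
  laurent q (q + l2%:~R) v + l2%:~R = laurent q (q + l2%:~R) w.
Proof.
move=> q0 q1 vw.
have u1 : q + 0%:~R \is a GRing.unit by rewrite addr0 unitfE.
have u2 : q + l2%:~R \is a GRing.unit by rewrite unitfE.
have [f ft] := R3_eval_ex u1 u2.
have fE x : f (mono x) = laurent q (q + l2%:~R) x.
  rewrite /monomial rmorph_laurent ?R3_t_unit ?R3_tl_unit //.
  by rewrite rmorphD /= ft rmorph_int.
by rewrite -!fE -vw rmorphD /= rmorph_int.
Qed.

(** Evaluating the equation at two rational points leaves equations between powers
    of 2 and 3: the first point makes one of t, t + l2 equal to 1 and the other
    equal to 2, the second makes them 2 and 3.  Together they determine all four
    exponents up to the two choices in the statement. *)
Lemma monomial_unit_equation v w : mono v + l2%:~R = mono w ->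
  exists2 b : 'M[int]_2, (b == 1) || (b == K_gen l2) & v = col 0 b /\ w = col 1 b.
Proof.
move=> vw; have ev q q0 q1 := @monomial_eval q v w q0 q1 vw.
suff [[-> ->]|[-> ->]] : (v = e 0 /\ w = e 1) \/
    (v = col 0 (K_gen l2) /\ w = col 1 (K_gen l2)).
- by exists 1; rewrite ?eqxx.
- by exists (K_gen l2); rewrite ?eqxx ?orbT.
move: l2P ev; rewrite !inE => /orP[]/eqP-> ev.
  have q1 : 1 + 1%:~R = 2 :> rat by rewrite mulr1z.
  have q2 : 2 + 1%:~R = 3 :> rat by rewrite mulr1z; lra.
  have := ev 1; rewrite q1 mulr1z /laurent !exp1rz !mul1r.
  move=> /(_ (oner_neq0 _) (lt0r_neq0 (ltr0n _ 2))) /esym/pow2_eq_succ[w1 v1].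
  have := ev 2; rewrite q2 mulr1z /laurent w1 v1 expr0z expr1z mulr1.
  move=> /(_ (lt0r_neq0 (ltr0n _ 2)) (lt0r_neq0 (ltr0n _ 3))) /esym.
  rewrite mulrC => /triple_pow2_eq_succ[[w0 v0]|[w0 v0]]; [left|right].
    by split; apply: cV2_eq; rewrite ?w0 ?w1 ?v0 ?v1 !mxE.
  by split; apply: cV2_eq; rewrite ?w0 ?w1 ?v0 ?v1 !mxE.
have q1 : 2 + (-1)%:~R = 1 :> rat by rewrite mulrN1z; lra.
have q2 : 3 + (-1)%:~R = 2 :> rat by rewrite mulrN1z; lra.
have eN (x y : rat) : x + (-1)%:~R = y -> x = y + 1.
  by rewrite mulrN1z => <-; rewrite subrK.
have := ev 2; rewrite q1 /laurent !exp1rz !mulr1.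
move=> /(_ (lt0r_neq0 (ltr0n _ 2)) (oner_neq0 _)) /eN/pow2_eq_succ[v0 w0].
have := ev 3; rewrite q2 /laurent w0 v0 expr0z expr1z mul1r.
move=> /(_ (lt0r_neq0 (ltr0n _ 3)) (lt0r_neq0 (ltr0n _ 2))) /eN.
move=> /triple_pow2_eq_succ[[v1 w1]|[v1 w1]]; [left|right].
  by split; apply: cV2_eq; rewrite ?w0 ?w1 ?v0 ?v1 !mxE.
by split; apply: cV2_eq; rewrite ?w0 ?w1 ?v0 ?v1 !mxE.
Qed.
End UnitEquation.

(** * The semidirect product of the ring by its monomials *)

Section Semidirect.
Variable l2 : int.
Local Notation R := (R3 0 l2).
Local Notation mono := (@monomial l2).

(** The pair (a, v) is the affine map P |-> a + x^v P of the ring; the group law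
    is composition, except that [v] is kept rather than the monomial x^v. *)
Record affineg := Affineg { transl : R; expo : 'cV[int]_2 }.

Definition affineg_pair (x : affineg) := (transl x, expo x).
Definition affineg_of_pair p := Affineg p.1 p.2.
Fact affineg_pairK : cancel affineg_pair affineg_of_pair. Proof. by case. Qed.

HB.instance Definition _ := Choice.copy affineg (can_type affineg_pairK).

Definition affineg_mul x y :=
  Affineg (transl x + mono (expo x) * transl y) (expo x + expo y).
Definition affineg_inv x :=
  Affineg (- (mono (- expo x) * transl x)) (- expo x).

Fact affineg_mulA : associative affineg_mul.
Proof.
move=> [a v] [b w] [c z]; rewrite /affineg_mul /= monomialD !addrA.
by rewrite mulrDr addrA mulrA.
Qed.
Fact affineg_mul1 : left_id (Affineg 0 0) affineg_mul.
Proof. by case=> a v; rewrite /affineg_mul /= monomial0 mul1r !add0r. Qed.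
Fact affineg_1mul : right_id (Affineg 0 0) affineg_mul.
Proof. by case=> a v; rewrite /affineg_mul /= mulr0 !addr0. Qed.
Fact affineg_mulV : left_inverse (Affineg 0 0) affineg_inv affineg_mul.
Proof. by case=> a v; rewrite /affineg_mul /= !addNr. Qed.
Fact affineg_Vmul : right_inverse (Affineg 0 0) affineg_inv affineg_mul.
Proof.
case=> a v; rewrite /affineg_mul /= subrr mulrN mulrA -monomialD subrr.
by rewrite monomial0 mul1r subrr.
Qed.

HB.instance Definition _ := isGroup.Build affineg
  affineg_mulA affineg_mul1 affineg_1mul affineg_mulV affineg_Vmul.

Lemma affinegM a v b w :
  (Affineg a v * Affineg b w)%g = Affineg (a + mono v * b) (v + w).
Proof. by []. Qed.

Lemma affineg1 : 1%g = Affineg 0 0 :> affineg.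
Proof. by []. Qed.

Lemma affinegV a v : (Affineg a v)^-1%g = Affineg (- (mono (- v) * a)) (- v).
Proof. by []. Qed.

Lemma affineg_split a v :
  Affineg a v = (Affineg a 0 * Affineg 0 v)%g.
Proof. by rewrite affinegM mulr0 addr0 add0r. Qed.

Lemma affineg_conj a v b w :
  (Affineg a v * Affineg b w * (Affineg a v)^-1)%g =
  Affineg (a + mono v * b - mono w * a) w.
Proof.
rewrite affinegV !affinegM mulrN mulrA -monomialD.
by rewrite (_ : v + w - v = w) // addrC addKr.
Qed.

Lemma affinegX v n : (Affineg 0 v ^+ n)%g = Affineg 0 (v *+ n).
Proof.
elim: n => [|n IH]; first by rewrite mulr0n.
by rewrite expgS IH affinegM mulr0 addr0 mulrS.
Qed.

End Semidirect.
Arguments Affineg {l2}.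
Arguments transl {l2}.
Arguments expo {l2}.

(** * Automorphisms of the semidirect product *)

Section Automorphisms.
Variable l2 : int.
Hypothesis l2P : l2 \in [:: 1; -1].
Local Notation R := (R3 0 l2).
Local Notation mono := (@monomial l2).
Local Notation G := (affineg l2).
Local Notation A := (@Affineg l2).
Local Notation K := (K_group l2).

(** The unit is 1 - (t + 1) = - t for l2 = 1, and 1 - t for l2 = -1.  This makes the
    ring part the derived subgroup of the semidirect product, and kills the first
    cohomology of Z^2 with coefficients in the ring. *)
Lemma sub1_monomial_unit : exists w : 'cV[int]_2, 1 - mono w \is a GRing.unit.
Proof.
move: l2P; rewrite !inE => /orP[]/eqP l2E.
  exists (e 1); rewrite monomial_e1 l2E mulr1z opprD addrCA subrr addr0.
  by rewrite unitrN -l2E R3_t_unit.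
exists (e 0); rewrite monomial_e0 -unitrN opprB.
by have := R3_tl_unit l2; rewrite [X in X%:~R]l2E mulrN1z.
Qed.

(** The translation part of f (0, v) is left free: two automorphisms with the same
    pair differ by an inner one. *)
Definition aut_spec (f : autg G) (u : R) (b : K) :=
  (forall a, f (A a 0) = A (u * ring_act l2P b a) 0) /\
  (forall v, expo (f (A 0 v)) = K_mx b *m v).

(** An element (a, 0) is the commutator of (c, 0) and (0, w) for
    c = a / (1 - x^w), and Z^2 is abelian. *)
Lemma autg_transl_expo (f : autg G) a : expo (f (A a 0)) = 0.
Proof.
have vM x y : expo (f (x * y)%g) = expo (f x) + expo (f y) by rewrite autgM.
have vV x : expo (f x^-1%g) = - expo (f x).
  by apply/eqP; rewrite -addr_eq0 -vM mulVg autg1.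
have [w uw] := sub1_monomial_unit.
pose c := a / (1 - mono w).
have -> : A a 0 = ((A c 0 * A 0 w * (A c 0)^-1) * (A 0 w)^-1)%g.
  rewrite affineg_conj affinegV affinegM !mulr0 oppr0 mulr0 !addr0 subrr.
  by rewrite -[X in X - _]mul1r -mulrBl mulrC divrK.
by rewrite !vM !vV addrAC addrK subrr.
Qed.

Lemma K_mx_inj : injective (@K_mx l2).
Proof. by move=> b c bc; apply/val_inj/uval_inj. Qed.

Lemma K_mx_onto (b : 'M[int]_2) : (b == 1) || (b == K_gen l2) ->
  exists k : K, K_mx k = b.
Proof.
move=> bK.
have bb : b * b = 1 by case/orP: bK => /eqP->; rewrite ?mulr1 ?K_gen2.
have ub : b \is a GRing.unit by apply/unitrP; exists b.
have kP : Unitg ub \in K_pred l2 by [].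
by exists (MkK kP).
Qed.

(** The action of [f] on the ring, [al], and on Z^2, [be], satisfy
    al (x^v a) = x^(be v) al a.  With u = al 1 the image of [al] lies in the
    ideal of [u], so surjectivity makes [u] a unit.  Applying al / u to the
    identity x^(0,1) = x^(1,0) + l2 gives an instance of the unit equation. *)
Lemma aut_spec_ex f : exists ub : unitg R * K, aut_spec f (uval ub.1) ub.2.
Proof.
pose al a := transl (f (A a 0)); pose be v := expo (f (A 0 v)).
have alE a : f (A a 0) = A (al a) 0.
  by rewrite -[in RHS](autg_transl_expo f a) /al; case: (f _).
have alD x y : al (x + y) = al x + al y.
  rewrite {1}/al; have -> : A (x + y) 0 = (A x 0 * A y 0)%g.
    by rewrite affinegM monomial0 mul1r addr0.
  by rewrite autgM !alE affinegM monomial0 mul1r.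
have alB : {morph al : x y / x - y}.
  by move=> x y; apply: (addIr (al y)); rewrite -alD !subrK.
have beD : {morph be : v w / v + w}.
  move=> v w; rewrite /be.
  have -> : A 0 (v + w) = (A 0 v * A 0 w)%g by rewrite affinegM mulr0 addr0.
  by rewrite autgM.
have alM v a : al (mono v * a) = mono (be v) * al a.
  rewrite {1}/al.
  have -> : A (mono v * a) 0 = (A 0 v * A a 0 * (A 0 v)^-1)%g.
    by rewrite affineg_conj add0r mulr0 subr0.
  rewrite autg_conj alE /be; case: (f (A 0 v)) => d w.
  by rewrite affineg_conj monomial0 mul1r /= addrAC subrr add0r.
pose u := al 1.
have alm v : al (mono v) = mono (be v) * u by rewrite -[mono v]mulr1 alM.
have uU : u \is a GRing.unit.
  have [a /= a1] : exists a, al a = 1.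
    exists (transl (autg_inv f (A 1 0))); rewrite /al.
    have -> : A (transl (autg_inv f (A 1 0))) 0 = autg_inv f (A 1 0).
      by have := autg_transl_expo (autg_inv f) 1; case: (autg_inv _ _) => ? ? /= ->.
    by rewrite autgVK.
  have : exists c, al a = u * c.
    elim/R3_ind: a {a1}.
      by move=> x y [c xc] [d yd]; exists (c - d); rewrite alB xc yd mulrBr.
    by move=> v; exists (mono (be v)); rewrite alm mulrC.
  by rewrite a1 => -[c /esym uc]; apply/unitrPr; exists c.
have [b bK [b0 b1]] : exists2 b : 'M[int]_2, (b == 1) || (b == K_gen l2) &
    be (e 0) = col 0 b /\ be (e 1) = col 1 b.
  apply: (@monomial_unit_equation l2 l2P); apply: (mulIr uU).
  pose F : {additive R -> R} := HB.pack al (GRing.isZmodMorphism.Build _ _ al alB).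
  rewrite mulrDl -!alm monomial_e1 -monomial_e0 alD; congr (_ + _).
  by rewrite -[RHS]/(F _) raddfMz /= -/u mulrC mulrzr.
have [k kb] := K_mx_onto _ bK.
have bev v : be v = K_mx k *m v by rewrite kb; apply: int_mx_additive.
exists (Unitg uU, k); split => //= a; rewrite alE; congr A.
move: a; apply: R3_zmod_eq => // [x y|v]; first by rewrite rmorphB mulrBr.
by rewrite alm bev ring_actE mulrC.
Qed.

Lemma aut_spec_inj f u b u' b' :
  aut_spec f u b -> aut_spec f u' b' -> u = u' /\ b = b'.
Proof.
move=> [fa fv] [fa' fv']; split.
  have := fa 1; rewrite fa' !rmorph1 !mulr1 => -[]; exact: esym.
apply: K_mx_inj; apply/matrixP => i j.
have := fv (e j); rewrite fv' !col1 -!colE => /matrixP/(_ i 0).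
by rewrite !mxE.
Qed.

Lemma aut_specM f g u b u' b' : aut_spec f u b -> aut_spec g u' b' ->
  aut_spec (f * g)%g (u * ring_act l2P b u') (b * b')%g.
Proof.
move=> [fa fv] [ga gv]; split=> [a|v].
  by rewrite [LHS](_ : _ = f (g (A a 0))) // ga fa rmorphM mulrA ring_actM.
rewrite [LHS](_ : _ = expo (f (g (A 0 v)))) //.
have := gv v; case: (g _) => d w /= ->.
by rewrite affineg_split autgM /= autg_transl_expo add0r fv K_mxM mulmxA.
Qed.

(** For the converse, v |-> d v is a 1-cocycle.  Since Z^2 is abelian,
    d v (1 - x^z) = d z (1 - x^v), so it is the coboundary of d z / (1 - x^z)
    as soon as 1 - x^z is a unit. *)
Lemma inner_spec (f : autg G) : (f \in Inn G) <-> exists w, aut_spec f (mono w) 1%g.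
Proof.
split=> [/asboolP[[q w] fE]|[w [fa fv]]].
  exists w; split=> [a|v]; rewrite fE affineg_conj.
    by rewrite monomial0 mul1r addrAC subrr add0r ring_act1.
  by rewrite K_mx1 mul1mx.
have [z uz] := sub1_monomial_unit.
pose d v := transl (f (A 0 v)).
have fE v : f (A 0 v) = A (d v) v.
  by have := fv v; rewrite K_mx1 mul1mx /d; case: (f _) => ? ? /= ->.
have dD v v' : d (v + v') = d v + mono v * d v'.
  rewrite {1}/d (_ : A 0 (v + v') = (A 0 v * A 0 v')%g).
    by rewrite autgM !fE affinegM.
  by rewrite affinegM mulr0 addr0.
apply/asboolP; exists (A (d z / (1 - mono z)) w) => -[a v].
rewrite affineg_conj affineg_split autgM fa ring_act1 fE affinegM.
rewrite monomial0 mul1r add0r; congr A.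
have -> : d v = d z / (1 - mono z) * (1 - mono v).
  rewrite mulrAC; apply: (mulIr uz); rewrite divrK //.
  apply/subr0_eq; transitivity (d (v + z) - d (z + v)); last by rewrite [v + z]addrC subrr.
  by rewrite !dD; ring.
by rewrite mulrBr mulr1 addrCA addrA [mono v * _]mulrC.
Qed.

(** The representative with trivial cocycle among the automorphisms that induce
    the pair (u, b). *)
Definition std_fun (u : unitg R) (b : K) (x : G) : G :=
  A (uval u * ring_act l2P b (transl x)) (K_mx b *m expo x).

Lemma std_funM u b : {morph std_fun u b : x y / (x * y)%g}.
Proof.
move=> [a v] [c w]; rewrite /std_fun !affinegM /=.
by rewrite rmorphD rmorphM /= ring_actE mulrDr mulmxDr mulrCA.
Qed.

Lemma std_fun_comp u b u' b' x :
  std_fun u b (std_fun u' b' x) = std_fun (u * unit_act l2P b u')%g (b * b')%g x.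
Proof.
by rewrite /std_fun /= rmorphM mulrA ring_actM K_mxM mulmxA.
Qed.

Lemma std_fun1 x : std_fun 1%g 1%g x = x.
Proof. by case: x => a v; rewrite /std_fun /= ring_act1 mul1r K_mx1 mul1mx. Qed.

Lemma std_fun_bij u b : bijective (std_fun u b).
Proof.
exists (std_fun (unit_act l2P b^-1%g u^-1%g) b^-1%g) => x;
  rewrite std_fun_comp ?mulVg ?mulgV.
  rewrite -unit_actM mulVg -[RHS]std_fun1; congr std_fun.
  by apply: uval_inj; rewrite /= rmorph1.
rewrite -[RHS]std_fun1; congr std_fun; apply: uval_inj => /=.
by rewrite -ring_actM mulgV ring_act1 divrr ?uvalP.
Qed.

Definition std_aut u b : autg G := Autg (std_funM u b) (std_fun_bij u b).

Lemma std_aut_spec u b : aut_spec (std_aut u b) (uval u) b.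
Proof. by split=> [a|v]; rewrite //= /std_fun /= mulmx0. Qed.

Lemma Out_affineg :
  isogg (Out G) (sdprodg (quotg (unitg R) (monomial_group l2)) K (K_act l2P)).
Proof.
pose c f := sval (cid (aut_spec_ex f)).
have cP f : aut_spec f (uval (c f).1) (c f).2 by rewrite /c; case: (cid _).
pose theta : {multiplicative K -> autg (quotg (unitg R) (monomial_group l2))} :=
  K_act l2P.
pose Phi f := Sdprod theta (cosetg (monomial_group l2) (c f).1) (c f).2.
have PhiE f u b : aut_spec f (uval u) b ->
    Phi f = Sdprod theta (cosetg (monomial_group l2) u) b.
  move=> fub; have [/uval_inj cu cb] := aut_spec_inj _ _ _ _ _ (cP f) fub.
  by rewrite /Phi cu cb.
have c1 u : (cosetg (monomial_group l2) u = 1%g) <-> (u \in monomial_group l2).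
  split=> [/esym/cosetgP|um]; first by rewrite invg1 mul1g.
  by apply/esym/cosetgP; rewrite invg1 mul1g.
apply: (@quotg_isogg _ _ _ Phi) => [f g|f|[q b]].
- rewrite (PhiE _ ((c f).1 * unit_act l2P (c f).2 (c g).1)%g ((c f).2 * (c g).2)%g).
    by rewrite cosetgM -quot_actE.
  exact: aut_specM.
- split=> [[/c1/asboolP[w uw] b1]|/inner_spec[w fw]].
    by apply/inner_spec; exists w; rewrite -uw -b1.
  rewrite (PhiE _ (Unitg (@monomial_unit l2 w)) 1%g) //.
  by congr Sdprod; apply/c1/asboolP; exists w.
- exists (std_aut (repr q) b); rewrite (PhiE _ _ _ (std_aut_spec _ _)).
  by rewrite cosetg_repr.
Qed.

End Automorphisms.

(** * The presented group is the semidirect product *)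

Section NormalForm.
Variable l2 : int.
Local Notation A := (@Affineg l2).
Local Notation mono := (@monomial l2).

Variables (H : groupType) (a x y : H) (f : H -> affineg l2).
Hypothesis xy : commute x y.
Hypothesis gen : forall P : H -> Prop, P 1%g ->
  (forall g h, g \in [:: a; x; y] -> P h -> P (g * h)%g /\ P (g^-1 * h)%g) ->
  forall h, P h.
Hypothesis fM : {morph f : g h / (g * h)%g}.
Hypotheses (fa : f a = A 1 0) (fx : f x = A 0 (e 0)) (fy : f y = A 0 (e 1)).

Variable E : {poly int} -> H.
Hypothesis E1 : E 1 = a.
Hypothesis EB : forall p q, E (p - q) = (E p / E q)%g.
Hypothesis EX : forall p, E ('X * p) = (E p ^ x^-1)%g.
Hypothesis EXl : forall p, E (('X + l2%:P) * p) = (E p ^ y^-1)%g.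

Let f1 : f 1%g = 1%g.
Proof. by apply: (mulgI (f 1%g)); rewrite -fM !mulg1. Qed.

Let fV h : f h^-1%g = (f h)^-1%g.
Proof. by apply: (mulgI (f h)); rewrite -fM !mulgV f1. Qed.

Let fX h n : f (h ^+ n)%g = (f h ^+ n)%g.
Proof. by elim: n => [|n IH]; rewrite ?f1 // !expgS fM IH. Qed.

Let fxy m n : f (x ^+ m * y ^+ n)%g = A 0 (e 0 *+ m + e 1 *+ n).
Proof. by rewrite fM !fX fx fy !affinegX affinegM mulr0 addr0. Qed.

Let E0 : E 0 = 1%g.
Proof. by rewrite -(subrr 0) EB mulgV. Qed.

Let ED p q : E (p + q) = (E p * E q)%g.
Proof. by rewrite -[q]opprK EB -[- q]sub0r EB E0 mul1g invgK opprB subr0. Qed.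

Let fE p : f (E p) = A (R3_poly 0 l2 p) 0.
Proof.
elim/intpoly_ind: p => [|p q IHp IHq|p IH].
- by rewrite E1 fa rmorph1.
- rewrite EB fM fV IHp IHq affinegV affinegM oppr0 monomial0 !mul1r addr0.
  by rewrite rmorphB.
- rewrite EX /conjg invgK !fM fV fx IH mulgA affineg_conj.
  by rewrite add0r mulr0 subr0 monomial_e0 rmorphM.
Qed.

Let E_monomial m n : E ('X ^+ m * ('X + l2%:P) ^+ n) = (a ^ (x ^+ m * y ^+ n)^-1)%g.
Proof.
elim: m => [|m IH].
  rewrite mul1r expg0 mul1g; elim: n => [|n IH].
    by rewrite expr0 E1 invg1 conjg1.
  by rewrite exprS EXl IH -conjgM -invgM expgS.
by rewrite exprS -mulrA EX IH -conjgM -invgM expgS mulgA.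
Qed.

(** The prefix x^m y^n clears the denominators of the ring, so that only
    polynomials and nonnegative exponents occur. *)
Definition has_normal_form (h : H) : Prop := exists m n p m' n',
  (x ^+ m * y ^+ n * h = E p * (x ^+ m' * y ^+ n'))%g.

(** The set of such [h] contains 1 and is stable under left multiplication by the
    generators and their inverses: x and y are moved across E(p) at the cost of
    multiplying [p] by 'X or 'X + l2, the inverses of x and y are absorbed by
    raising [m] or [n], and [a] becomes the monomial 'X^m ('X + l2)^n when
    x^m y^n is moved across it. *)
Lemma normal_formP h : has_normal_form h.
Proof.
elim/gen: h => [|g h]; first by exists 0, 0, 0, 0, 0; rewrite E0 !expg0 !mulg1.
rewrite !inE => g_gen [m [n [p [m' [n' h_nf]]]]].
have xw k l : commute x (x ^+ k * y ^+ l)%g.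
  by apply: commuteM; apply: commuteX => //; apply: commute_refl.
have yw k l : commute y (x ^+ k * y ^+ l)%g.
  by apply: commuteM; apply: commuteX; [apply: commute_sym | apply: commute_refl].
have xS k l : (x ^+ k.+1 * y ^+ l = x * (x ^+ k * y ^+ l))%g by rewrite expgS mulgA.
have yS k l : (x ^+ k * y ^+ l.+1 = y * (x ^+ k * y ^+ l))%g.
  by rewrite yw -mulgA expgSr.
have w_mul (c : H) : (x ^+ m * y ^+ n * (c * h) =
    c ^ (x ^+ m * y ^+ n)^-1 * (E p * (x ^+ m' * y ^+ n')))%g.
  by rewrite mulgA (conjgCV _ c) -mulgA h_nf.
case/or3P: g_gen => /eqP->.
- pose c := 'X ^+ m * ('X + l2%:P) ^+ n : {poly int}.
  split; [exists m, n, (c + p), m', n' | exists m, n, (- c + p), m', n'].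
    by rewrite w_mul ED E_monomial mulgA.
  by rewrite w_mul ED -[- c]sub0r EB E0 mul1g E_monomial conjVg mulgA.
- split; [exists m, n, ('X * p), m'.+1, n' | exists m.+1, n, p, m', n'].
    by rewrite mulgA -xw -mulgA h_nf mulgA (conjgCV x) -EX -mulgA xS.
  by rewrite xS xw -mulgA mulVKg.
- split; [exists m, n, (('X + l2%:P) * p), m', n'.+1 | exists m, n.+1, p, m', n'].
    by rewrite mulgA -yw -mulgA h_nf mulgA (conjgCV y) -EXl -mulgA yS.
  by rewrite yS yw -mulgA mulVKg.
Qed.

(** In the semidirect product the normal form of [h] reads off p, m' - m and n' - n,
    which all vanish when [h] has trivial image. *)
Let f_inj h : f h = 1%g -> h = 1%g.
Proof.
move=> h1; have [m [n [p [m' [n' h_nf]]]]] := normal_formP h.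
have : f (x ^+ m * y ^+ n * h)%g = f (E p * (x ^+ m' * y ^+ n'))%g by rewrite h_nf.
rewrite (fM _ h) h1 mulg1 (fM (E p)) fE !fxy affinegM mulr0 addr0 add0r.
move=> fe; have p0 := congr1 transl fe; have /matrixP vE := congr1 expo fe.
move: p0 vE h_nf => /= p0 vE {fe}.
have -> : m = m' by have := vE 0 0; rewrite -!scaler_nat !mxE /=; lia.
have -> : n = n' by have := vE 1 0; rewrite -!scaler_nat !mxE /=; lia.
have -> : p = 0 by apply: (@R3_poly_inj 0 l2); rewrite -p0 rmorph0.
by rewrite E0 mul1g -[in X in _ = X -> _](mulg1 (x ^+ _ * y ^+ _)%g) => /mulgI.
Qed.

Let f_surj z : exists h, f h = z.
Proof.
pose im z := exists h, f h = z.
have imM z1 z2 : im z1 -> im z2 -> im (z1 * z2)%g.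
  by move=> [h1 <-] [h2 <-]; exists (h1 * h2)%g; rewrite fM.
have imV z1 : im z1 -> im z1^-1%g by move=> [h <-]; exists h^-1%g; rewrite fV.
have im_exp v (n : int) : im (A 0 v) -> im (A 0 (v *~ n)).
  move=> vim; have imn k : im (A 0 (v *+ k)).
    by rewrite -affinegX; case: vim => h <-; exists (h ^+ k)%g; rewrite fX.
  case: n => k; first exact: imn.
  have -> : A 0 (v *~ Negz k) = (A 0 (v *+ k.+1))^-1%g.
    by rewrite affinegV mulr0 oppr0 NegzE mulrNz.
  exact: imV.
have im_vec v : im (A 0 v).
  have -> : v = e 0 *~ v 0 0 + e 1 *~ v 1 0.
    by apply: cV2_eq; rewrite !mxE -!scaler_int !mxE /=; lia.
  have -> u w : A 0 (u + w) = (A 0 u * A 0 w)%g by rewrite affinegM mulr0 addr0.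
  by apply: imM; apply: im_exp; [exists x | exists y].
have im_lin b : im (A b 0).
  elim/R3_ind: b => [b c bim cim|v].
    have -> : A (b - c) 0 = (A b 0 / A c 0)%g.
      by rewrite affinegV affinegM oppr0 monomial0 !mul1r addr0.
    by apply: imM => //; apply: imV.
  have -> : A (mono v) 0 = (A 0 v * A 1%R 0 * (A 0 v)^-1)%g.
    by rewrite affineg_conj add0r mulr1 mulr0 subr0.
  by apply: (imM); [apply: (imM) => //; exists a | apply: imV].
by case: z => b v; rewrite affineg_split; apply: imM.
Qed.

Lemma normal_form_isogg : isogg H (affineg l2).
Proof. exact: isogg_inj_surj fM f_inj f_surj. Qed.

End NormalForm.

Section BaumslagGroup.
Local Open Scope group_scope.

Local Notation ba := (wordg BMG_rels gen_a).
Local Notation bs := (wordg BMG_rels gen_s).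
Local Notation bt := (wordg BMG_rels gen_t).

Lemma BMG_commute : commute bs bt.
Proof.
rewrite /commute -!wordgM.
by apply: (@wordg_rel _ BMG_rels (gen_s ++ gen_t, gen_t ++ gen_s)); rewrite !inE eqxx.
Qed.

Lemma BMG_commute_conj : commute ba (ba ^ bt^-1).
Proof.
have : wordg BMG_rels (comm_word gen_a (conj_word gen_a gen_t)) = 1.
  by apply: (@wordg_rel _ BMG_rels (_, [::])); rewrite !inE eqxx orbT.
rewrite /comm_word /conj_word !wordgM !wordgV !wordgM !wordgV.
by rewrite /conjg invgK => h; apply: divg1_eq; rewrite invgM -mulgA.
Qed.

Lemma BMG_mul_conj : ba * ba ^ bs^-1 = ba ^ bt^-1.
Proof.
have : wordg BMG_rels (gen_a ++ conj_word gen_a gen_s) =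
    wordg BMG_rels (conj_word gen_a gen_t).
  by apply: (@wordg_rel _ BMG_rels (_, _)); rewrite !inE eqxx !orbT.
by rewrite /conj_word !wordgM !wordgV /conjg !invgK.
Qed.

Lemma BMG_ind (P : BMG -> Prop) : P 1 ->
  (forall g h, g \in [:: ba; bs; bt] -> P h -> P (g * h) /\ P (g^-1 * h)) ->
  forall h, P h.
Proof.
move=> P1 PM; apply: presg_ind => // i b q Pq.
have ig : wordg BMG_rels [:: (i, true)] \in [:: ba; bs; bt].
  suff [->|[->|->]] : i = inord 0 \/ i = inord 1 \/ i = inord 2 by rewrite !inE eqxx ?orbT.
  case: i => [[|[|[|]]]] //= ?; [left|right;left|right;right];
    by apply: val_inj; rewrite /= inordK.
have [Pg PgV] := PM _ _ ig Pq.
by case: b => //; rewrite -wordgV in PgV.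
Qed.

Local Open Scope ring_scope.

Lemma BMG_lift l2 (v w : 'cV[int]_2) : 1 + monomial l2 v = monomial l2 w ->
  exists2 f : BMG -> affineg l2, {morph f : x y / (x * y)%g} &
    [/\ f ba = Affineg 1 0, f bs = Affineg 0 v & f bt = Affineg 0 w].
Proof.
move=> vw.
pose g (i : 'I_3) : affineg l2 :=
  nth 1%g [:: Affineg 1 0; Affineg 0 v; Affineg 0 w] i.
have ga : word_eval g gen_a = Affineg 1 0.
  by rewrite word_eval_letter /g inordK.
have gs : word_eval g gen_s = Affineg 0 v.
  by rewrite word_eval_letter /g inordK.
have gt : word_eval g gen_t = Affineg 0 w.
  by rewrite word_eval_letter /g inordK.
have gC u : (Affineg 0 u * (Affineg 1%R 0 * (Affineg 0 u)^-1))%g =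
    Affineg (monomial l2 u) 0.
  by rewrite mulgA affineg_conj add0r mulr1 mulr0 subr0.
have gE := (word_eval_cat, word_eval_inv).
have [|f fM fE] := @presg_lift _ BMG_rels _ g.
  move=> r; rewrite !inE => /or3P[]/eqP->; rewrite /fst /snd.
  - by rewrite !gE gs gt !affinegM !mulr0 [v + w]addrC.
  - rewrite /comm_word /conj_word !gE ga gt.
    rewrite gC !affinegV !affinegM oppr0 monomial0 !mul1r !addr0 /= affineg1.
    congr Affineg; ring.
  - by rewrite /conj_word !gE ga gs gt !gC affinegM monomial0 mul1r addr0 vw.
by exists f => //; rewrite !fE.
Qed.

(** The exponents of [poly_conj_ex] are inverted because conjugation in the
    presentation is g a g^-1.  For l2 = 1 the letter s is the variable of the
    ring and t is s + 1.  For l2 = -1 the letter t is the variable and s is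
    t - 1, whence the substitution of 'X + 1 for 'X. *)
Lemma BMG_affineg l2 : l2 \in [:: 1; -1] -> isogg BMG (affineg l2).
Proof.
have [E [E1 EB Es Et]] :=
  @poly_conj_ex BMG ba bs^-1%g bt^-1%g (commuteV2 _ _ _ BMG_commute)
    BMG_commute_conj BMG_mul_conj.
rewrite !inE => /orP[]/eqP->.
  have [|f fM [fa fs ft]] := @BMG_lift 1 (col 0 1%:M) (col 1 1%:M).
    by rewrite monomial_e0 monomial_e1 mulr1z addrC.
  exact: (@normal_form_isogg 1 BMG ba bs bt f BMG_commute BMG_ind fM fa fs ft E).
have [|f fM [fa fs ft]] := @BMG_lift (-1) (col 1 1%:M) (col 0 1%:M).
  by rewrite monomial_e0 monomial_e1 mulrN1z addrC subrK.
apply: (@normal_form_isogg (-1) BMG ba bt bs f _ _ fM fa ft fs (fun p => E (p \Po ('X + 1)))).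
- exact/commute_sym/BMG_commute.
- move=> P P1 PM; apply: BMG_ind => // g h gin; apply: PM.
  by move: gin; rewrite !inE => /or3P[]->; rewrite ?orbT.
- by rewrite comp_polyC.
- by move=> p q; rewrite comp_polyB EB.
- by move=> p; rewrite comp_polyM comp_polyX Et.
- by move=> p; rewrite comp_polyM comp_polyD comp_polyX comp_polyC polyCN addrK Es.
Qed.
End BaumslagGroup.

(** * The two-element group K and the conclusion *)

Lemma K_group_Z2 (l2 : int) : isogg (K_group l2) 'Z_2.
Proof.
pose f (b : K_group l2) : 'Z_2 := if K_mx b == 1 then 0 else 1.
have gen1 : K_gen l2 != 1.
  apply/eqP => /matrixP h; have := h 0 0; have := h 1 1.
  by rewrite /K_gen; case: eqP => _; rewrite !mxE.
have fM : {morph f : b c / (b * c)%g}.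
  move=> b c; rewrite /f K_mxM.
  have /orP[/eqP bE|/eqP bE] := valP b; have /orP[/eqP cE|/eqP cE] := valP c;
    rewrite /K_mx bE cE ?mul1r ?mulr1 ?K_gen2 ?eqxx ?(negPf gen1) //; exact: val_inj.
apply: (isogg_inj_surj _ _ f fM) => [b|z].
  rewrite /f; case: eqP => // b1 _; exact: K_mx_inj.
have [k kb] := K_mx_onto l2 (K_gen l2) (introT orP (or_intror (eqxx _))).
case: z => [[|[|//]]] z2; [exists 1%g | exists k]; apply: val_inj.
  by rewrite /f K_mx1 eqxx.
by rewrite /f kb (negPf gen1).
Qed.

Theorem theorem5p2 (l2 : int) (hl2 : l2 \in [:: 1; -1]) :
  isogg (Out BMG)
        (sdprodg (quotg (unitg (R3 0 l2)) (monomial_group l2))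
                 (K_group l2) (K_act hl2)) /\
  isogg (K_group l2) 'Z_2.
Proof.
split; last exact: K_group_Z2.
exact: isogg_trans (Out_isogg _ _ (BMG_affineg _ hl2)) (Out_affineg _ hl2).
Qed.
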